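(* Let $M$ be a smooth proper variety over $\mathbb{C}$ of dimension $4$, let $n\geqslant 0$ be an integer, let $\mathscr{E}$ and $\mathscr{F}$ be vector bundles on $M$ of the same rank $n+1$, and let $\sigma:\mathscr{E}\to\mathscr{F}$ be an $n$-general morphism of vector bundles. If the determinantal hypersurface $D_n(\sigma)$ is irreducible, then $D_n(\sigma)$ is nodal, i.e. all of its singular points are ordinary double points.
   Context: All varieties are irreducible and defined over $\mathbb{C}$. Degeneracy loci: for a morphism $\sigma:\mathscr{E}\to\mathscr{F}$ of vector bundles of rank $n+1$ on $M$ and $0\leqslant i\leqslant n$, the $i$-th degeneracy locus is $D_i(\sigma)=\{x\in M\mid \mathrm{rank}(\sigma(x))\leqslant i\}$, with the scheme structure whose ideal is locally generated by the $(i+1)\times(i+1)$-minors of a matrix for $\sigma$; by convention $D_{-1}(\sigma)=\varnothing$. The locus $D_n(\sigma)$ is the zero scheme of $\det\sigma$, a section of $\det\mathscr{E}^\vee\otimes\det\mathscr{F}$; it is called a determinantal hypersurface if it has codimension one in $M$. $n$-general: $\sigma$ is $n$-general if for every $i=0,1,\dots,n$ the locally closed subset $D_i(\sigma)\setminus D_{i-1}(\sigma)$, with the induced scheme structure, is smooth of codimension $(n+1-i)^2$ in $M$ (it is allowed to be empty). An ordinary double point of a 3-dimensional hypersurface is a singular point at which the hypersurface is locally analytically isomorphic to $\{x_1^2+x_2^2+x_3^2+x_4^2=0\}\subset\mathbb{C}^4$ at the origin. *)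

(* Defs.v *)
From HB Require Import structures.
From mathcomp Require Import all_boot all_order all_algebra.
From mathcomp Require Import all_classical all_reals all_analysis.
From mathcomp Require Import complex.
From mathcomp Require mpoly.
(* Importing the notations of mpoly would clash with mathcomp-analysis. *)
Export -(notations) mpoly.
Set Implicit Arguments.
Unset Strict Implicit.
Unset Printing Implicit Defensive.
Import Order.TTheory GRing.Theory Num.Theory.
Import numFieldNormedType.Exports.
Local Open Scope classical_set_scope.
Local Open Scope ring_scope.

(* The field of complex numbers is R[i], for R : realType.
   Varieties are varieties in the sense of Serre: a set of (closed) points with
   a finite atlas of affine algebraic sets, glued along open subsets by regular
   maps.  Since everything is of finite type over C, all local conditions below
   are imposed at closed points. *)

(* The usual topology and norm on R[i], as a normed space over itself. *)
HB.instance Definition _ (R : realType) := NormedModule.copy R[i] R[i]^o.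

Section AffineSpace.
Variables (R : realType) (N : nat).

Definition peval (P : mpoly N R[i]) (z : 'rV[R[i]]_N) : R[i] :=
  meval (fun k => z ord0 k) P.

Definition algebraic_set (Z : set 'rV[R[i]]_N) : Prop :=
  exists S : set (mpoly N R[i]), Z = [set z | forall P, S P -> peval P z = 0].

End AffineSpace.

(* In [chart_compat], [Q] exhibits a principal open neighbourhood of [x] in
   [chart_dom c] that is contained in [chart_dom c'] and on which the
   coordinates of [c'] are the fractions [P k / Q] in the coordinates of [c]. *)
Record prevariety (R : realType) := Prevariety {
  point :> Type;
  chart : finType;
  chart_dim : chart -> nat;
  chart_dom : chart -> set point;
  coord : forall c : chart, point -> 'rV[R[i]]_(chart_dim c);
  chart_cover : forall x, exists c, chart_dom c x;
  coord_inj : forall c x y, chart_dom c x -> chart_dom c y ->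
    coord c x = coord c y -> x = y;
  coord_affine : forall c, algebraic_set (coord c @` chart_dom c);
  chart_compat : forall c c' x, chart_dom c x -> chart_dom c' x ->
    exists (Q : mpoly (chart_dim c) R[i])
           (P : 'I_(chart_dim c') -> mpoly (chart_dim c) R[i]),
      peval Q (coord c x) != 0 /\
      forall y, chart_dom c y -> peval Q (coord c y) != 0 ->
        chart_dom c' y /\
        forall k, coord c' y ord0 k
                  = peval (P k) (coord c y) / peval Q (coord c y)
}.

Section Prevarieties.
Variable R : realType.
Implicit Types M Y : prevariety R.

Definition zariski_open M (U : set M) : Prop :=
  forall x, U x -> exists (c : chart M) (Q : mpoly (chart_dim c) R[i]),
    [/\ chart_dom c x, peval Q (coord c x) != 0
      & forall y, chart_dom c y -> peval Q (coord c y) != 0 -> U y].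

Definition zariski_closed M (Z : set M) : Prop := zariski_open (~` Z).

(* The Zariski topology of the product variety, which is not the product of
   the Zariski topologies. *)
Definition zariski_open_prod M Y (U : set (M * Y)) : Prop :=
  forall x y, U (x, y) ->
    exists (c : chart M) (d : chart Y)
           (Q : mpoly (chart_dim c + chart_dim d) R[i]),
      [/\ chart_dom c x, chart_dom d y,
          peval Q (row_mx (coord c x) (coord d y)) != 0
        & forall x' y', chart_dom c x' -> chart_dom d y' ->
            peval Q (row_mx (coord c x') (coord d y')) != 0 -> U (x', y')].

Definition zariski_closed_prod M Y (Z : set (M * Y)) : Prop :=
  zariski_open_prod (~` Z).

Definition separated M : Prop :=
  zariski_closed_prod [set xy : M * M | xy.1 = xy.2].

Definition irreducible_subset M (Z : set M) : Prop :=
  Z !=set0 /\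
  forall A B : set M, zariski_closed A -> zariski_closed B ->
    Z `<=` A `|` B -> Z `<=` A \/ Z `<=` B.

(* The germ of [f] at [x] belongs to the local ring of [M] at [x]. *)
Definition regular_at M (x : M) (f : M -> R[i]) : Prop :=
  exists (c : chart M) (P Q : mpoly (chart_dim c) R[i]),
    [/\ chart_dom c x, peval Q (coord c x) != 0
      & forall y, chart_dom c y -> peval Q (coord c y) != 0 ->
          f y = peval P (coord c y) / peval Q (coord c y)].

(* The functions whose germ at [x] lies in the ideal of the local ring at [x]
   generated by the germs of the [g t]. *)
Definition ideal_at M (T : finType) (g : T -> M -> R[i]) (x : M) :
    set (M -> R[i]) :=
  [set f | exists h : T -> M -> R[i],
    (forall t, regular_at x (h t)) /\
    exists U : set M, [/\ zariski_open U, U x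
      & forall y, U y -> f y = \sum_t h t y * g t y]].

Definition zero_ideal_at M : M -> set (M -> R[i]) :=
  ideal_at (fun (_ : 'I_0) (_ : M) => 0).

(* The ideal of polynomials, in the coordinates of the chart [c], which defines
   the same closed subscheme germ as [I]; it contains the equations of [M]. *)
Definition chart_ideal M (c : chart M) (I : set (M -> R[i])) :
    set (mpoly (chart_dim c) R[i]) :=
  [set P | I (fun y => peval P (coord c y))].
Arguments chart_ideal [M] c I.

(* Jacobian definition of smoothness over C, of relative dimension [d], at [x],
   for the closed subscheme of [M] with ideal [I] in the local ring at [x]:
   near [x] the subscheme is cut out scheme-theoretically, in an affine space
   of dimension [r + d], by [r] equations whose Jacobian matrix has rank [r]
   at [x].  This does not depend on the chart used. *)
Definition smooth_at M (x : M) (I : set (M -> R[i])) (d : nat) : Prop :=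
  exists c : chart M, chart_dom c x /\
  exists (r : nat) (f : 'I_r -> mpoly (chart_dim c) R[i]),
    [/\ chart_dim c = (r + d)%N,
        forall j, chart_ideal c I (f j),
        forall P, chart_ideal c I P ->
          exists (Q : mpoly (chart_dim c) R[i])
                 (h : 'I_r -> mpoly (chart_dim c) R[i]),
            peval Q (coord c x) != 0 /\ Q * P = \sum_j h j * f j
      & \rank (\matrix_(j < r, k < chart_dim c)
                 peval (mderiv k (f j)) (coord c x)) = r].

Definition smooth_of_dim M (m : nat) : Prop :=
  forall x : M, smooth_at x (zero_ideal_at x) m.

(* Smooth of codimension [e] at [x], in an ambient variety of dimension [m]. *)
Definition smooth_of_codim_at (m : nat) M (x : M) (I : set (M -> R[i]))
    (e : nat) : Prop :=
  exists d : nat, (d + e)%N = m /\ smooth_at x I d.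

End Prevarieties.
Arguments chart_ideal [R M] c I.

Record variety (R : realType) := Variety {
  variety_space :> prevariety R;
  variety_separated : separated variety_space;
  variety_irreducible : irreducible_subset [set: variety_space]
}.

(* Properness over C, separatedness being part of [variety]: the projection
   M x Y -> Y is closed for every variety Y. *)
Definition proper_variety (R : realType) (M : variety R) : Prop :=
  forall (Y : variety R) (Z : set (M * Y)),
    zariski_closed_prod Z -> zariski_closed (snd @` Z).

Section VectorBundles.
Variable R : realType.

(* A vector bundle of rank [r], given by a trivializing open cover;
   [trans a b] turns (column) coordinates in the trivialization [a] into
   coordinates in the trivialization [b]. *)
Record vbundle (M : prevariety R) (r : nat) := VBundle {
  triv : Type;
  triv_dom : triv -> set M;
  trans : triv -> triv -> M -> 'M[R[i]]_r;
  triv_open : forall a, zariski_open (triv_dom a);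
  triv_cover : forall x, exists a, triv_dom a x;
  trans_regular : forall a b x, triv_dom a x -> triv_dom b x ->
    forall k l, regular_at x (fun y => trans a b y k l);
  trans_id : forall a x, triv_dom a x -> trans a a x = 1%:M;
  trans_cocycle : forall a b c x,
    triv_dom a x -> triv_dom b x -> triv_dom c x ->
    trans b c x *m trans a b x = trans a c x
}.

Record vbmorphism (M : prevariety R) (r s : nat)
    (E : vbundle M r) (F : vbundle M s) := VBMorphism {
  mor_mx : triv E -> triv F -> M -> 'M[R[i]]_(s, r);
  mor_regular : forall a b x, triv_dom a x -> triv_dom b x ->
    forall k l, regular_at x (fun y => mor_mx a b y k l);
  mor_compat : forall a a' b b' x,
    triv_dom a x -> triv_dom a' x -> triv_dom b x -> triv_dom b' x ->
    mor_mx a' b' x *m trans a a' x = trans b b' x *m mor_mx a b x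
}.

Section Degeneracy.
Variables (M : prevariety R) (n : nat) (E F : vbundle M n.+1).
Variable sigma : vbmorphism E F.

Definition degeneracy_locus (i : nat) : set M :=
  [set x | exists a b, [/\ triv_dom a x, triv_dom b x
                         & (\rank (mor_mx sigma a b x) <= i)%N]].

(* The stalks of the ideal sheaf generated by the minors of size i+1.  Row and
   column selections need not be increasing: this only adds zeros and minors up
   to sign to the generators. *)
Definition degeneracy_ideal (i : nat) (x : M) : set (M -> R[i]) :=
  [set f | exists a b, [/\ triv_dom a x, triv_dom b x
    & ideal_at (fun (t : {ffun 'I_i.+1 -> 'I_n.+1} * {ffun 'I_i.+1 -> 'I_n.+1})
                    (y : M) => \det (mxsub t.1 t.2 (mor_mx sigma a b y))) x f]].

Definition degeneracy_stratum (i : nat) : set M :=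
  degeneracy_locus i `\` (if i is j.+1 then degeneracy_locus j else set0).

(* The stratum is open in the [i]-th locus, so the ideal of its induced scheme
   structure at [x] is that of the locus; [m] is the dimension of [M]. *)
Definition n_general (m : nat) : Prop :=
  forall (i : nat) (x : M), (i <= n)%N -> degeneracy_stratum i x ->
    smooth_of_codim_at m x (degeneracy_ideal i x) ((n.+1 - i) ^ 2)%N.

End Degeneracy.
End VectorBundles.

Section AnalyticGerms.
Variable R : realType.

(* Differentiability on a neighbourhood is complex differentiability, the
   field of scalars being R[i]. *)
Definition holomorphic_near (N : nat) (V : normedModType R[i])
    (p : 'rV[R[i]]_N) (f : 'rV[R[i]]_N -> V) : Prop :=
  \forall z \near p, differentiable f z.

(* The germ of [g] at [p] lies in the ideal generated by [J] in the ring of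
   germs at [p] of holomorphic functions. *)
Definition analytic_ideal (N : nat) (J : set (mpoly N R[i])) (p : 'rV[R[i]]_N)
    (g : 'rV[R[i]]_N -> R[i]) : Prop :=
  exists (r : nat) (f : 'I_r -> mpoly N R[i]) (h : 'I_r -> 'rV[R[i]]_N -> R[i]),
    [/\ forall j, J (f j), forall j, holomorphic_near p (h j)
      & \forall z \near p, g z = \sum_j h j z * peval (f j) z].

(* The complex analytic space germs (V(J), p) and (V(K), q), with J and K sets
   of polynomials vanishing at p and q, are isomorphic. *)
Definition analytic_germ_iso (N L : nat)
    (J : set (mpoly N R[i])) (p : 'rV[R[i]]_N)
    (K : set (mpoly L R[i])) (q : 'rV[R[i]]_L) : Prop :=
  exists (Phi : 'rV[R[i]]_N -> 'rV[R[i]]_L) (Psi : 'rV[R[i]]_L -> 'rV[R[i]]_N),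
    [/\ holomorphic_near p Phi /\ holomorphic_near q Psi,
        Phi p = q /\ Psi q = p,
        forall f, K f -> analytic_ideal J p (fun z => peval f (Phi z)),
        forall f, J f -> analytic_ideal K q (fun w => peval f (Psi w))
      & (forall k, analytic_ideal J p (fun z => Psi (Phi z) ord0 k - z ord0 k)) /\
        (forall k, analytic_ideal K q (fun w => Phi (Psi w) ord0 k - w ord0 k))].

Definition node_equation : mpoly 4 R[i] :=
  \sum_(k < 4) mpolyX R[i] (mnm1 k) ^+ 2.

Variable M : prevariety R.

Definition singular_at (x : M) (I : set (M -> R[i])) : Prop :=
  ~ exists d, smooth_at x I d.

Definition ordinary_double_point (x : M) (I : set (M -> R[i])) : Prop :=
  singular_at x I /\
  exists c : chart M, chart_dom c x /\
    analytic_germ_iso (chart_ideal c I) (coord c x) [set node_equation] 0.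

(* For the closed subscheme of [M] with support [Z] and ideal sheaf stalks
   [I x]. *)
Definition nodal (Z : set M) (I : M -> set (M -> R[i])) : Prop :=
  forall x, Z x -> singular_at x (I x) -> ordinary_double_point x (I x).

End AnalyticGerms.

(* Main.v *)
From HB Require Import structures.
From mathcomp Require Import all_boot all_order all_algebra.
From mathcomp Require Import all_classical all_reals all_analysis.
From mathcomp Require Import complex ring lra.
Require Import Defs.

(** Let x be a point of the hypersurface and r the rank of sigma there. The
stratum of rank r is smooth of codimension (n + 1 - r)^2 at x. If r = n it is
the hypersurface itself near x, which is then smooth at x. Otherwise that
codimension is at least 4, while M has dimension 4: so r = n - 1 and the
stratum is, near x, the reduced point x ([corank_eq2]).

Near x, row and column operations reduce sigma to a 2 x 2 matrix B vanishing
at x: det(B) generates the ideal of the hypersurface and the entries of B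
generate that of the stratum. The latter being the maximal ideal, the four
entries of B are local analytic coordinates on M, and the hypersurface is
b11 b22 - b12 b21 = 0, a nondegenerate quadric cone.

The algebraic part is done with tangent vectors rather than with ideals. A
tangent vector v at x that kills the entries of B makes sigma factor through
dimension n - 1 modulo the square of the parameter ([corank2_local_model]), so
it kills all minors of size n ([degeneracy_ideal_jet0]), that is, the ideal of
the reduced point x, and v = 0 ([vanishing_jets_tangent0]). Hence, in a chart
where M is cut out by q equations g in dimension q + 4, the q + 4 functions
(g, B) have an invertible Jacobian matrix at x.

The analytic part is an inverse function theorem for polynomial maps
([local_inverse], [analytic_section]), which rests on divided differences:
G(z) - G(w) = (z - w) A(z, w) with A a matrix of polynomials. Where A is
invertible, this identity yields the contraction that solves G(z) = u, the
holomorphy of the solution, and the membership in the ideal of g of the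
difference between z and its projection to the zero locus of g, as required
of an isomorphism of germs ([node_germ_iso]). *)

Set Implicit Arguments.
Unset Strict Implicit.
Unset Printing Implicit Defensive.
Import Order.TTheory GRing.Theory Num.Theory.
Import numFieldNormedType.Exports.
Local Open Scope classical_set_scope.
Local Open Scope ring_scope.

(** * Polynomial functions and their divided differences *)

Lemma mpoly_ring_ind (R : realType) (n : nat) (P : mpoly n R[i] -> Prop) :
  (forall c, P (mpolyC n c)) -> (forall i, P (mpolyX R[i] (mnm1 i))) ->
  (forall p q, P p -> P q -> P (p + q)) ->
  (forall p q, P p -> P q -> P (p * q)) -> forall p, P p.
Proof.
move=> PC PX PD PM; apply: mpolyind => [|c m p _ _ Pp].
  by rewrite -mpolyC0; exact: PC.
apply: (PD) => //; rewrite -mul_mpolyC; apply: (PM) => //.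
rewrite mpolyXE_id.
apply: (big_ind P); [by rewrite -mpolyC1; exact: PC | exact: PM |].
move=> i _; elim: (m i) => [|k IH]; first by rewrite expr0 -mpolyC1; exact: PC.
by rewrite exprS; exact: PM.
Qed.

Notation mxpeval A z := (map_mx (fun P => peval P z) A).

Section Evaluation.
Variables (R : realType) (N : nat).
Implicit Types (P Q : mpoly N R[i]) (z w : 'rV[R[i]]_N).

Lemma pevalC c z : peval (mpolyC N c) z = c.
Proof. exact: mevalC. Qed.

Lemma pevalX i z : peval (mpolyX R[i] (mnm1 i)) z = z ord0 i.
Proof. exact: mevalXU. Qed.

Lemma peval0 z : peval 0 z = 0.
Proof. exact: meval0. Qed.

Lemma peval1 z : peval 1 z = 1.
Proof. exact: meval1. Qed.

Lemma pevalD P Q z : peval (P + Q) z = peval P z + peval Q z.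
Proof. exact: mevalD. Qed.

Lemma pevalB P Q z : peval (P - Q) z = peval P z - peval Q z.
Proof. exact: mevalB. Qed.

Lemma pevalM P Q z : peval (P * Q) z = peval P z * peval Q z.
Proof. exact: mevalM. Qed.

Lemma pevalXn P k z : peval (P ^+ k) z = peval P z ^+ k.
Proof. exact: rmorphXn. Qed.

Lemma peval_sum (I : Type) (s : seq I) (p : pred I) (F : I -> mpoly N R[i]) z :
  peval (\sum_(i <- s | p i) F i) z = \sum_(i <- s | p i) peval (F i) z.
Proof. exact: rmorph_sum. Qed.

Lemma peval_det k (A : 'M[mpoly N R[i]]_k) z :
  peval (\det A) z = \det (mxpeval A z).
Proof. exact/esym/(det_map_mx (meval (fun k => z ord0 k))). Qed.

Lemma peval_adj k (A : 'M[mpoly N R[i]]_k) z :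
  mxpeval (\adj A) z = \adj (mxpeval A z).
Proof. exact: (map_mx_adj (meval (fun k => z ord0 k))). Qed.

Lemma peval_mulmx j k l (A : 'M[mpoly N R[i]]_(j, k))
    (B : 'M[mpoly N R[i]]_(k, l)) z :
  mxpeval (A *m B) z = mxpeval A z *m mxpeval B z.
Proof. exact: (map_mxM (meval (fun k => z ord0 k))). Qed.

Lemma peval_mderivX i k z :
  peval (mderiv k (mpolyX R[i] (mnm1 i))) z = (k == i)%:R.
Proof.
rewrite mderivX mnm1E eq_sym; case: eqVneq => [->|_].
  rewrite (_ : mnm_sub _ _ = mnm0); last first.
    by apply/mnmP => j; rewrite mnmBE mnm0E subnn.
  by rewrite scale1r mpolyX0 peval1.
by rewrite scale0r peval0.
Qed.

Lemma differentiable_peval (V : normedModType R[i]) (phi : V -> 'rV[R[i]]_N)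
    (v : V) P :
  (forall k, differentiable (fun u => phi u ord0 k) v) ->
  differentiable (fun u => peval P (phi u)) v.
Proof.
move=> dphi; elim/mpoly_ring_ind: P => [c|k|P Q dP dQ|P Q dP dQ].
- by under eq_fun do rewrite pevalC; exact: differentiable_cst.
- by under eq_fun do rewrite pevalX; exact: dphi.
- by under eq_fun do rewrite pevalD; exact: differentiableD.
- by under eq_fun do rewrite pevalM; exact: differentiableM.
Qed.

Lemma continuous_peval P : continuous (peval P : 'rV[R[i]]_N -> R[i]).
Proof.
move=> z; apply: differentiable_continuous.
by apply: differentiable_peval => k; exact: differentiable_coord.
Qed.

(** The coefficients of P(z) - P(w) on the z_k - w_k are themselves
polynomials, in the pair (z, w). With these the analysis below never needs
Taylor's formula: inverting a matrix of divided differences yields inverse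
maps, their differentiability, and Hadamard's lemma. *)
Definition divided_differences P (D : 'I_N -> mpoly (N + N) R[i]) : Prop :=
  (forall z w, peval P z - peval P w
     = \sum_k (z ord0 k - w ord0 k) * peval (D k) (row_mx z w)) /\
  (forall z k, peval (D k) (row_mx z z) = peval (mderiv k P) z).

Lemma exists_mpoly_lift P : exists Pl Pr : mpoly (N + N) R[i], forall z w,
  peval Pl (row_mx z w) = peval P z /\ peval Pr (row_mx z w) = peval P w.
Proof.
elim/mpoly_ring_ind: P =>
  [c|k|P Q [Pl [Pr PE]] [Ql [Qr QE]]|P Q [Pl [Pr PE]] [Ql [Qr QE]]].
- by exists (mpolyC _ c), (mpolyC _ c) => z w; rewrite /peval !mevalC.
- exists (mpolyX _ (mnm1 (lshift N k))), (mpolyX _ (mnm1 (rshift N k))) => z w.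
  by rewrite /peval !mevalXU row_mxEl row_mxEr.
- exists (Pl + Ql), (Pr + Qr) => z w; have [] := PE z w; have [] := QE z w.
  by rewrite /peval !mevalD => -> -> -> ->.
- exists (Pl * Ql), (Pr * Qr) => z w; have [] := PE z w; have [] := QE z w.
  by rewrite /peval !mevalM => -> -> -> ->.
Qed.

End Evaluation.

Lemma exists_divided_differences (R : realType) (N : nat) (P : mpoly N R[i]) :
  exists D, divided_differences P D.
Proof.
elim/mpoly_ring_ind: P =>
  [c|j|P Q [D [DE Dd]] [D' [DE' Dd']]|P Q [D [DE Dd]] [D' [DE' Dd']]].
- exists (fun=> mpolyC _ 0); split=> [z w|z k].
    by rewrite !pevalC subrr big1// => k _ /=; rewrite mulr0.
  by rewrite mderivC peval0 pevalC.
- exists (fun k => (k == j)%:R); split=> [z w|z k].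
    rewrite !pevalX (bigD1 j)//= eqxx big1 ?addr0.
      by rewrite peval1 mulr1.
    by move=> k /negbTE -> /=; rewrite peval0 mulr0.
  rewrite peval_mderivX; case: (k == j); first exact: peval1.
  exact: peval0.
- exists (fun k => D k + D' k); split=> [z w|z k].
    rewrite !pevalD opprD addrACA DE DE' -big_split/=.
    by apply: eq_bigr => k _; rewrite pevalD mulrDr.
  by rewrite mderivD !pevalD Dd Dd'.
- have [Pl [Pr PE]] := exists_mpoly_lift P.
  have [Ql [Qr QE]] := exists_mpoly_lift Q.
  (* Leibniz: Q is evaluated at the second point and P at the first. *)
  exists (fun k => Qr * D k + Pl * D' k); split=> [z w|z k].
    transitivity (peval Q w * (peval P z - peval P w)
                  + peval P z * (peval Q z - peval Q w)).
      by rewrite !pevalM; ring.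
    rewrite DE DE' !mulr_sumr -big_split/=; apply: eq_bigr => k _.
    rewrite pevalD !pevalM (QE z w).2 (PE z w).1; ring.
  rewrite mderivM !pevalD !pevalM (QE z z).2 (PE z z).1 Dd Dd'.
  move: (peval P z) (peval Q z).
  move: (peval (mderiv k P) z) (peval (mderiv k Q) z).
  by move=> a b a' b'; ring.
Qed.

(** * Contractions of complex affine space *)

HB.instance Definition _ (R : realType) n := Complete.on 'rV[R]_n.

Section MatrixNorm.
Variable K : numFieldType.

Lemma mx_norm_leP m n (A : 'M[K]_(m, n)) (e : K) : 0 <= e ->
  (`|A| <= e) <-> (forall i j, `|A i j| <= e).
Proof.
move=> /nonnegP[{}e]; rewrite [`|A|]mx_normE num_le; split.
  by move=> /bigmax_leP[_ Ae] i j; have := Ae (i, j) isT; rewrite -num_le.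
move=> Ae; apply/bigmax_leP; split=> [|[i j] _]; rewrite -num_le//=.
Qed.

Lemma mx_entry_le_norm m n (A : 'M[K]_(m, n)) i j : `|A i j| <= `|A|.
Proof. by have /mx_norm_leP := lexx `|A|; apply. Qed.

Lemma mx_norm_mul m n p (A : 'M[K]_(m, n)) (B : 'M[K]_(n, p)) :
  `|A *m B| <= n%:R * `|A| * `|B|.
Proof.
apply/mx_norm_leP => [|i j]; first by rewrite !mulr_ge0.
rewrite mxE; apply: le_trans (ler_norm_sum _ _ _) _.
apply: le_trans (_ : \sum_(k < n) `|A| * `|B| <= _).
  by apply: ler_sum => k _; rewrite normrM ler_pM // mx_entry_le_norm.
by rewrite sumr_const card_ord -mulrA mulr_natl.
Qed.

End MatrixNorm.

Lemma normc_ge_Im (R : rcfType) (z : R[i]) : `|complex.Im z|%:C%C <= `|z|.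
Proof.
by rewrite normc_def lecR -sqrtr_sqr; apply: ler_wsqrtr; rewrite lerDr sqr_ge0.
Qed.

Lemma normc_le_ReIm (R : rcfType) (z : R[i]) :
  `|z| <= (`|complex.Re z| + `|complex.Im z|)%:C%C.
Proof.
rewrite normc_def lecR -[leRHS]ger0_norm ?addr_ge0// -[`|_ + _|]sqrtr_sqr.
apply: ler_wsqrtr.
rewrite -[complex.Re z ^+ 2]real_normK ?num_real//.
rewrite -[complex.Im z ^+ 2]real_normK ?num_real//.
by rewrite sqrrD -addrA lerD2l lerDr mulrn_wge0// mulr_ge0.
Qed.

Section ComplexContraction.
Variables (R : realType) (N : nat).
Implicit Types (x y : 'rV[R]_(N + N)) (z w : 'rV[R[i]]_N).

(** C^N is seen as the real Banach space R^(N + N); the complex and real sup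
norms differ by a factor of at most 2. *)
Definition complex_row x : 'rV[R[i]]_N :=
  \row_k (x ord0 (lshift N k) +i* x ord0 (rshift N k))%C.

Definition real_row z : 'rV[R]_(N + N) :=
  row_mx (\row_k complex.Re (z ord0 k)) (\row_k complex.Im (z ord0 k)).

Lemma real_rowK : cancel real_row complex_row.
Proof.
move=> z; apply/rowP => k; rewrite mxE /real_row row_mxEl row_mxEr !mxE.
by case: (z ord0 k).
Qed.

Lemma complex_rowB x y : complex_row (x - y) = complex_row x - complex_row y.
Proof. by apply/rowP => k; rewrite !mxE. Qed.

Lemma real_rowB z w : real_row (z - w) = real_row z - real_row w.
Proof.
apply/rowP => k; rewrite !mxE.
by case: fintype.splitP => j _; rewrite !mxE raddfB.
Qed.

Lemma norm_real_row z (e : R) : `|z| <= e%:C%C -> `|real_row z| <= e.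
Proof.
move=> ze; have e0 : 0 <= e by rewrite -lecR (le_trans _ ze).
apply/mx_norm_leP => // i k; rewrite ord1 mxE.
have zke j : `|z ord0 j| <= e%:C%C by exact: le_trans (mx_entry_le_norm _ _ _) ze.
case: fintype.splitP => j _; rewrite mxE -lecR; apply: le_trans (zke j).
  exact: normc_ge_Re.
exact: normc_ge_Im.
Qed.

Lemma norm_complex_row x (e : R) : `|x| <= e -> `|complex_row x| <= (2 * e)%:C%C.
Proof.
move=> xe; have e0 : 0 <= e by rewrite (le_trans _ xe).
have xke j : `|x ord0 j| <= e by exact: le_trans (mx_entry_le_norm _ _ _) xe.
apply/mx_norm_leP => [|i k]; first by rewrite lecR mulr_ge0.
rewrite ord1 mxE (le_trans (normc_le_ReIm _))//= lecR mulr_natl mulr2n.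
by rewrite lerD.
Qed.

(** The fixed point is found in the real ball of radius r, which the complex
ball of radius 2r contains; the ratio 1/4 becomes 1/2 for the real norm. *)
Lemma complex_contraction_fixpoint (T : 'rV[R[i]]_N -> 'rV[R[i]]_N) p (r : R) :
    0 < r ->
    (forall z w, `|z - p| <= (2 * r)%:C%C -> `|w - p| <= (2 * r)%:C%C ->
      `|T z - T w| <= 4^-1 * `|z - w|) ->
    `|T p - p| <= (r / 2)%:C%C ->
  exists2 z, `|z - p| <= (2 * r)%:C%C & T z = z.
Proof.
move=> r0 Tlip Tp.
pose U := closed_ball_ (@Num.norm R _) (real_row p) r.
have UE x : U x -> `|complex_row x - p| <= (2 * r)%:C%C.
  rewrite /U /closed_ball_/= distrC => xr.
  rewrite -[p]real_rowK -complex_rowB; exact: norm_complex_row.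
pose f x := real_row (T (complex_row x)).
have flip x y : U x -> U y -> `|f x - f y| <= 2^-1 * `|x - y|.
  move=> Ux Uy; rewrite /f -real_rowB; apply: norm_real_row.
  apply: le_trans (Tlip _ _ (UE _ Ux) (UE _ Uy)) _.
  rewrite -complex_rowB.
  apply: le_trans (_ : 4^-1 * (2 * `|x - y|)%:C%C <= _).
    by rewrite ler_wpM2l ?invr_ge0// norm_complex_row.
  have -> : 4^-1 = (4^-1 : R)%:C%C :> R[i].
    by rewrite fmorphV rmorph_nat.
  rewrite -rmorphM lecR; lra.
have fU : {homo f : x / U x >-> U x}.
  move=> x Ux; rewrite /U /closed_ball_/= distrC.
  rewrite -real_rowB; apply: norm_real_row.
  rewrite -(subrK (T p) (T _)) -addrA (le_trans (ler_normD _ _))//.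
  have -> : r%:C%C = 4^-1 * (2 * r)%:C%C + (r / 2)%:C%C :> R[i].
    have -> : 4^-1 = (4^-1 : R)%:C%C :> R[i] by rewrite fmorphV rmorph_nat.
    by rewrite -rmorphM -rmorphD; congr (_%:C%C); lra.
  rewrite lerD//.
  apply: le_trans (Tlip _ _ (UE _ Ux) _) _.
    by rewrite subrr normr0 lecR mulr_ge0// ltW.
  by rewrite ler_wpM2l ?invr_ge0// UE.
have fun_f : isFun _ _ U U f by constructor.
pose F : {fun U >-> U} := HB.pack f fun_f.
have [|||x Ux xE] := @banach_fixed_point R 'rV[R]_(N + N) U F.
- exists (2^-1)%:nng; split=> /=; first by rewrite invf_lt1// ltr1n.
  by move=> [x y] [Ux Uy]; exact: flip.
- exact: closed_closed_ball_.
- by exists (real_row p); rewrite /U /closed_ball_/= subrr normr0 ltW.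
exists (complex_row x); first exact: UE.
by rewrite [in RHS]xE /= /f real_rowK.
Qed.

End ComplexContraction.

(** * Inverting a map through its difference quotient *)

Lemma complex_pos_real (R : realType) (e : R[i]) : 0 < e ->
  exists2 r : R, 0 < r & e = r%:C%C.
Proof. by case: e => a b; rewrite ltcE/= => /andP[/eqP-> a0]; exists a. Qed.

Section LocalInverse.
Variables (R : realType) (N : nat) (A : 'M[mpoly (N + N) R[i]]_N).
Variables (G : 'rV[R[i]]_N -> 'rV[R[i]]_N) (p : 'rV[R[i]]_N).
Hypothesis GA : forall z w, G z - G w = (z - w) *m mxpeval A (row_mx z w).
Hypothesis A_unit : mxpeval A (row_mx p p) \in unitmx.

Let L := invmx (mxpeval A (row_mx p p)).

(** Near (p, p) the slope A(z, w) is close to A(p, p), because its entries are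
polynomials. *)
Lemma slope_near_identity : exists2 r : R, 0 < r &
  forall z w, `|z - p| <= (2 * r)%:C%C -> `|w - p| <= (2 * r)%:C%C ->
  N%:R * `|1%:M - mxpeval A (row_mx z w) *m L| <= 4^-1.
Proof.
pose KP : 'M[mpoly (N + N) R[i]]_N :=
  1%:M - A *m map_mx (mpolyC (N + N) (R:=R[i])) L.
have KPE y : mxpeval KP y = 1%:M - mxpeval A y *m L.
  apply/matrixP => i j; rewrite !mxE pevalB peval_sum; congr (_ - _).
    by case: eqP => _; [exact: meval1 | exact: meval0].
  by apply: eq_bigr => k _; rewrite pevalM !mxE pevalC.
pose e : R[i] := (4 * N.+1%:R)^-1.
have e0 : 0 < e by rewrite invr_gt0 mulr_gt0.
have KP0 i j : peval (KP i j) (row_mx p p) = 0.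
  transitivity (mxpeval KP (row_mx p p) i j); first by rewrite [RHS]mxE.
  by rewrite KPE mulmxV// subrr mxE.
have : \forall y \near row_mx p p, forall ij : 'I_N * 'I_N,
    `|peval (KP ij.1 ij.2) y| < e.
  apply: (@filter_forall 'rV[R[i]]_(N+N) ('I_N * 'I_N)%type
    (fun ij y => `|peval (KP ij.1 ij.2) y| < e) (nbhs (row_mx p p)) _)
    => -[i j] /=.
  have /cvgrPdist_lt/(_ _ e0) := @continuous_peval _ _ (KP i j) (row_mx p p).
  by rewrite KP0; apply: filterS => y; rewrite sub0r normrN.
move=> /nbhs_ballP[d /= /complex_pos_real[r r0 ->] near_p].
exists (r / 4); first by rewrite divr_gt0.
have rlt : (2 * (r / 4))%:C%C < r%:C%C :> R[i] by rewrite ltcR; lra.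
move=> z w zp wp; rewrite -KPE.
have Ke : `|mxpeval KP (row_mx z w)| <= e.
  apply/mx_norm_leP => [|i j]; first exact: ltW.
  rewrite mxE ltW//; apply: (near_p (row_mx z w) _ (i, j)).
  split; first by rewrite ltcR.
  move=> i' j'; rewrite ord1 -ball_normE/= !mxE distrC.
  case: fintype.splitP => k _; apply: le_lt_trans rlt.
    by apply: le_trans zp; have := mx_entry_le_norm (z - p) 0 k; rewrite !mxE.
  by apply: le_trans wp; have := mx_entry_le_norm (w - p) ord0 k; rewrite !mxE.
apply: le_trans (_ : N%:R * e <= _); first by rewrite ler_wpM2l.
rewrite /e invfM mulrCA ler_piMr ?invr_ge0//.
by rewrite ler_pdivrMr// mul1r ler_nat.
Qed.

Lemma slope_estimate (r : R) :
    (forall z w, `|z - p| <= (2 * r)%:C%C -> `|w - p| <= (2 * r)%:C%C ->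
      N%:R * `|1%:M - mxpeval A (row_mx z w) *m L| <= 4^-1) ->
  forall z w (v : 'rV[R[i]]_N),
  `|z - p| <= (2 * r)%:C%C -> `|w - p| <= (2 * r)%:C%C ->
  `|v - v *m mxpeval A (row_mx z w) *m L| <= 4^-1 * `|v|.
Proof.
move=> small z w v zp wp; rewrite -mulmxA -[v in v - _]mulmx1 -mulmxBr.
apply: le_trans (mx_norm_mul _ _) _.
by rewrite mulrAC ler_wpM2r// small.
Qed.

(** G(z) = u is solved by the fixed points of z - (G(z) - u) L, where L inverts
the derivative A(p, p). This map sends z and w to points that differ by
(z - w)(1 - A(z, w) L), so it is a contraction near p. The same estimate makes
G injective, with a Lipschitz inverse, and every slope A(z, w) invertible. *)
Lemma local_inverse : G p = 0 ->
  exists r d c : R[i], [/\ 0 < r, 0 < d, 0 < c,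
    forall u, `|u| < d -> exists2 z, `|z - p| < r & G z = u
  & forall z w, `|z - p| < r -> `|w - p| < r ->
      mxpeval A (row_mx z w) \in unitmx /\ `|z - w| <= c * `|G z - G w| ].
Proof.
move=> Gp; have [r r0 small] := slope_near_identity.
have est := slope_estimate small.
pose l : R[i] := 1 + N%:R * `|L|.
have l0 : 0 < l by rewrite ltr_pwDl// mulr_ge0.
have uL (u : 'rV[R[i]]_N) : `|u *m L| <= l * `|u|.
  apply: le_trans (mx_norm_mul _ _) _.
  by rewrite mulrAC ler_wpM2r// /l lerDr.
have r4 : 0 < (r / 4)%:C%C :> R[i] by rewrite ltcR divr_gt0.
have rr : (2 * r)%:C%C > 0 :> R[i] by rewrite ltcR mulr_gt0.
have c4 : (1 : R[i]) - 4^-1 > 0 by rewrite subr_gt0 invf_lt1// ltr1n.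
exists (2 * r)%:C%C, ((r / 4)%:C%C / l), (l / (1 - 4^-1)); split => //.
- by rewrite divr_gt0.
- by rewrite divr_gt0.
- move=> u ud; pose T w := w - (G w - u) *m L.
  have sub z : `|z - p| <= (2 * (r / 2))%:C%C -> `|z - p| <= (2 * r)%:C%C.
    by move=> /le_trans; apply; rewrite lecR; lra.
  have [|z w /sub zp /sub wp||z zp Tz] :=
    @complex_contraction_fixpoint _ _ T p (r / 2).
  + by rewrite divr_gt0.
  + rewrite (_ : T z - T w = z - w - (G z - G w) *m L); last first.
      rewrite /T !mulmxBl; move: (G z *m L) (G w *m L) (u *m L) => gz gw ul.
      by apply/rowP => j; rewrite !mxE; ring.
    by rewrite [G z - G w]GA; exact: est.
  + rewrite /T Gp sub0r mulNmx opprK addrAC subrr add0r.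
    apply: le_trans (uL u) _.
    have -> : r / 2 / 2 = r / 4 by lra.
    by rewrite -ler_pdivlMl// mulrC ltW.
  + exists z; first by apply: le_lt_trans zp _; rewrite ltcR; lra.
    move: Tz; rewrite /T => /eqP; rewrite -subr_eq0 addrAC subrr add0r oppr_eq0.
    move=> /eqP/(congr1 (mulmx^~ (mxpeval A (row_mx p p)))).
    by rewrite mul0mx mulmxKV// => /eqP; rewrite subr_eq0 => /eqP.
- move=> z w /ltW zp /ltW wp; split.
    rewrite -row_free_unit; apply: inj_row_free => v v0.
    have := est z w v zp wp; rewrite v0 mul0mx subr0.
    rewrite -subr_ge0 -{2}[`|v|]mul1r -mulrBl -opprB mulNr oppr_ge0.
    by rewrite pmulr_rle0// normr_le0 => /eqP.
  rewrite mulrAC ler_pdivlMr// mulrC mulrBl mul1r lerBlDr.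
  rewrite -{1}[z - w](subrK ((G z - G w) *m L)) addrC.
  rewrite (le_trans (ler_normD _ _))// lerD//.
  by rewrite {1}GA; exact: est.
Qed.

End LocalInverse.

(** * Complex differentiability *)

Section Differentiability.
Variable R : realType.

Lemma near_norm_lt (V : normedModType R[i]) (x y : V) (e : R[i]) :
  `|y - x| < e -> \forall z \near y, `|z - x| < e.
Proof.
move=> yxe; apply/nbhs_ballP.
exists (e - `|y - x|) => [/=|z]; first by rewrite subr_gt0.
rewrite -ball_normE/= => zy.
rewrite -(subrK y z) -addrA (le_lt_trans (ler_normD _ _))//.
by rewrite distrC -ltrBrDr.
Qed.

Lemma near_norm_small (V : normedModType R[i]) (y : V) (e : R[i]) :
  `|y| < e -> \forall z \near y, `|z| < e.
Proof.
move=> ye; have := @near_norm_lt V 0 y e; rewrite subr0 => /(_ ye).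
by apply: filterS => z; rewrite subr0.
Qed.

Lemma differentiable_row (V : normedModType R[i]) n (f : V -> 'rV[R[i]]_n) x :
  (forall k, differentiable (fun y => f y ord0 k) x) -> differentiable f x.
Proof.
move=> df.
have -> : f = \sum_(k < n) (fun y => f y ord0 k *: delta_mx ord0 k).
  by apply/funext => y; rewrite fct_sumE [LHS]row_sum_delta.
by apply: differentiable_sum => k; exact: differentiableZl.
Qed.

Lemma differentiable_littleo (V : normedModType R[i]) (f : V -> R[i]) x :
  f x = 0 ->
  (forall e : R[i], 0 < e -> \forall y \near x, `|f y| <= e * `|y - x|) ->
  differentiable f x.
Proof.
move=> fx0 fo.
have fE : f \o shift x = cst (f x) + \0 +o_ 0 id.
  apply/eqaddoP => e e0; rewrite fx0 [\forall x \near _, _](near_shift x).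
  apply: filterS (fo e e0) => y; rewrite /= !fctE/= sub0r.
  by rewrite addr0 subr0 subrK.
have c0 : continuous (\0 : V -> R[i]) by move=> y; exact: cvg_cst.
by apply/diff_locallyP; rewrite (diff_unique c0 fE).
Qed.

Lemma continuous_of_lipschitz_at (V W : normedModType R[i]) (f : V -> W) x
    (c : R[i]) :
  0 < c -> (\forall y \near x, `|f y - f x| <= c * `|y - x|) ->
  {for x, continuous f}.
Proof.
move=> c0 flip; apply/cvgrPdist_lt => e e0.
have : \forall y \near x, `|y - x| < e / c.
  by apply: near_norm_lt; rewrite subrr normr0 divr_gt0.
apply: filterS2 flip => y fy yx; rewrite distrC (le_lt_trans fy)//.
by rewrite mulrC -ltr_pdivlMr.
Qed.

(** Caratheodory's criterion: f minus the linear form with coefficients m_i(x)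
is negligible before y - x, by continuity of the slopes m_i. *)
Lemma differentiable_slope n (f : 'rV[R[i]]_n -> R[i])
    (m : 'I_n -> 'rV[R[i]]_n -> R[i]) x :
  (forall i, {for x, continuous (m i)}) ->
  (\forall y \near x, f y - f x = \sum_i (y ord0 i - x ord0 i) * m i y) ->
  differentiable f x.
Proof.
move=> mc fE.
pose t := fun y : 'rV[R[i]]_n => f x + \sum_i (y ord0 i - x ord0 i) * m i x.
have dt : differentiable t x.
  apply: differentiableD; first exact: differentiable_cst.
  have -> : (fun y : 'rV_n => \sum_i (y ord0 i - x ord0 i) * m i x) =
     \sum_i (fun y : 'rV[R[i]]_n => (y ord0 i - x ord0 i) * m i x).
    by apply/funext => y; rewrite fct_sumE.
  apply: differentiable_sum => i.
  apply: differentiableM; last exact: differentiable_cst.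
  apply: differentiableB; first exact: differentiable_coord.
  exact: differentiable_cst.
have -> : f = (f - t) + t by rewrite subrK.
apply: differentiableD; last exact: dt.
apply: differentiable_littleo => [|e e0].
  rewrite !fctE /t big1 ?addr0 ?subrr// => i _; rewrite subrr mul0r//.
have en0 : 0 < e / n.+1%:R by rewrite divr_gt0.
have : \forall y \near x, forall i, `|m i y - m i x| < e / n.+1%:R.
  apply: (@filter_forall 'rV[R[i]]_n 'I_n
    (fun i y => `|m i y - m i x| < e / n.+1%:R) (nbhs x) _) => i.
  have /cvgrPdist_lt/(_ _ en0) := mc i.
  by apply: filterS => y; rewrite distrC.
apply: filterS2 fE => y fE my.
rewrite !fctE /t opprD addrA fE -sumrB.
under eq_bigr do rewrite -mulrBr.
rewrite (le_trans (ler_norm_sum _ _ _))//.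
apply: le_trans (_ : \sum_(i < n) `|y - x| * (e / n.+1%:R) <= _).
  apply: ler_sum => i _; rewrite normrM ler_pM//; last exact/ltW/my.
  by have := mx_entry_le_norm (y - x) ord0 i; rewrite !mxE.
rewrite sumr_const card_ord -mulrnAr mulrC ler_wpM2r//.
rewrite -mulrnAr -[e in leRHS]mulr1 ler_wpM2l//; first exact: ltW.
rewrite ltW// -[_^-1 *+ _]mulr_natr mulrC.
by rewrite ltr_pdivrMr// mul1r ltr_nat.
Qed.

Lemma differentiable_peval_row N d (b : 'I_d -> mpoly N R[i])
    (z : 'rV[R[i]]_N) :
  differentiable (fun w : 'rV[R[i]]_N => \row_i peval (b i) w) z.
Proof.
apply: differentiable_row => k; under eq_fun do rewrite mxE.
by apply: differentiable_peval => l; exact: differentiable_coord.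
Qed.

Lemma holomorphic_everywhere N (V : normedModType R[i]) (z : 'rV[R[i]]_N)
    (f : 'rV[R[i]]_N -> V) :
  (forall w, differentiable f w) -> holomorphic_near z f.
Proof.
by move=> df; rewrite /holomorphic_near; near=> w; exact: df.
Unshelve. all: by end_near. Qed.

End Differentiability.

(** * Holomorphic parametrizations of smooth zero loci *)

Section AnalyticSection.
Variables (R : realType) (q d : nat).
Variables (g : 'I_q -> mpoly (q + d) R[i]) (b : 'I_d -> mpoly (q + d) R[i]).
Variable p : 'rV[R[i]]_(q + d).
Hypothesis gp : forall j, peval (g j) p = 0.
Hypothesis bp : forall i, peval (b i) p = 0.
Hypothesis jacobian_free : forall v : 'rV[R[i]]_(q + d),
  (forall j, \sum_k v ord0 k * peval (mderiv k (g j)) p = 0) ->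
  (forall i, \sum_k v ord0 k * peval (mderiv k (b i)) p = 0) -> v = 0.

Let Phi (z : 'rV[R[i]]_(q + d)) : 'rV[R[i]]_d := \row_i peval (b i) z.
Let G (z : 'rV[R[i]]_(q + d)) : 'rV[R[i]]_(q + d) :=
  row_mx (\row_j peval (g j) z) (Phi z).

Lemma exists_slope : exists A : 'M[mpoly ((q + d) + (q + d)) R[i]]_(q + d),
  (forall z w, G z - G w = (z - w) *m mxpeval A (row_mx z w)) /\
  mxpeval A (row_mx p p) \in unitmx.
Proof.
have [Dg DgP] := choice (fun j => exists_divided_differences (g j)).
have [Db DbP] := choice (fun i => exists_divided_differences (b i)).
pose A : 'M[mpoly ((q + d) + (q + d)) R[i]]_(q + d) :=
  \matrix_(k, l) match fintype.split l with inl j => Dg j k | inr i => Db i k end.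
exists A; split=> [z w|].
  apply/rowP => l; rewrite mxE [RHS]mxE.
  under eq_bigr do rewrite !mxE.
  rewrite !mxE; case: fintype.splitP => [j|i] _; rewrite !mxE.
    by rewrite (DgP j).1.
  by rewrite (DbP i).1.
rewrite -row_free_unit; apply: inj_row_free => v /rowP vA0.
apply: jacobian_free => [j|i].
  have := vA0 (lshift d j); rewrite !mxE => vj; rewrite -[RHS]vj.
  apply: eq_bigr => k _; rewrite !mxE (unsplitK (inl j)).
  by rewrite (DgP j).2.
have := vA0 (rshift q i); rewrite !mxE => vi; rewrite -[RHS]vi.
apply: eq_bigr => k _; rewrite !mxE (unsplitK (inr i)).
by rewrite (DbP i).2.
Qed.

(** The inverse slope is written by Cramer's rule, so that its entries are
quotients of polynomials in the two points. *)
Lemma cramer_slope N (A : 'M[mpoly (N + N) R[i]]_N) (y : 'rV[R[i]]_(N + N))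
    (u v : 'rV[R[i]]_N) k :
  mxpeval A y \in unitmx -> u = v *m mxpeval A y ->
  v ord0 k = \sum_l u ord0 l * ((peval (\det A) y)^-1 * peval (\adj A l k) y).
Proof.
move=> uA ->; rewrite -[in LHS](mulmxK uA v) [LHS]mxE; apply: eq_bigr => l _.
by rewrite /invmx uA peval_det -peval_adj !mxE.
Qed.

Lemma unit_peval_det N (A : 'M[mpoly (N + N) R[i]]_N) (y : 'rV[R[i]]_(N + N)) :
  mxpeval A y \in unitmx -> peval (\det A) y != 0.
Proof. by rewrite peval_det unitmxE unitfE. Qed.

(** With G = (g, b), the map Psi(w) = G^-1(0, w) parametrizes the zero locus of
g by the values of b. It is holomorphic since Psi(w) - Psi(w') is (0, w - w')
times the inverse slope. For the retraction Psi o b, the points Psi(b(z)) and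
z have the same b-coordinates, hence differ by g(z) times the inverse slope:
this is the membership in the ideal generated by g. *)
Lemma analytic_section :
  exists (Psi : 'rV[R[i]]_d -> 'rV[R[i]]_(q + d))
         (h : 'I_q -> 'I_(q + d) -> 'rV[R[i]]_(q + d) -> R[i]),
  [/\ Psi 0 = p, holomorphic_near 0 Psi,
      \forall w \near (0 : 'rV[R[i]]_d),
        (forall j, peval (g j) (Psi w) = 0) /\ Phi (Psi w) = w,
      forall j k, holomorphic_near p (h j k)
    & \forall z \near p, forall k,
        Psi (Phi z) ord0 k - z ord0 k = \sum_j h j k z * peval (g j) z].
Proof.
have [A [GA Aunit]] := exists_slope.
have Gp : G p = 0.
  by apply/rowP => l; rewrite !mxE; case: fintype.splitP => j _; rewrite !mxE.
have [r [e [c [r0 e0 c0 surj inj]]]] := local_inverse GA Aunit Gp.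
have emb_norm (w : 'rV[R[i]]_d) : `|row_mx (0 : 'rV[R[i]]_q) w| <= `|w|.
  apply/mx_norm_leP => // i l; rewrite !mxE; case: fintype.splitP => j _.
    by rewrite mxE normr0.
  exact: mx_entry_le_norm.
pose Psi w := xget p [set z | `|z - p| < r /\ G z = row_mx 0 w].
have PsiP w : `|w| < e -> `|Psi w - p| < r /\ G (Psi w) = row_mx 0 w.
  move=> we; have [z zr Gz] := surj _ (le_lt_trans (emb_norm w) we).
  apply: (@xgetPex _ p [set z | `|z - p| < r /\ G z = row_mx 0 w]).
  by exists z.
have near0 : \forall w \near (0 : 'rV[R[i]]_d), `|w| < e.
  by apply: near_norm_small; rewrite normr0.
have nearw (w : 'rV[R[i]]_d) : `|w| < e -> \forall w' \near w, `|w'| < e.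
  exact: near_norm_small.
have embB w w' : row_mx 0 w - row_mx 0 w' = row_mx (0 : 'rV[R[i]]_q) (w - w').
  by rewrite opp_row_mx add_row_mx subrr.
have Psi_lip w w' : `|w| < e -> `|w'| < e -> `|Psi w - Psi w'| <= c * `|w - w'|.
  move=> /PsiP[wr Gw] /PsiP[wr' Gw'].
  apply: le_trans (inj _ _ wr wr').2 _; rewrite ler_wpM2l ?(ltW c0)//.
  by rewrite Gw Gw' embB; exact: emb_norm.
have Psi_diff w : `|w| < e -> differentiable Psi w.
  move=> we; apply: differentiable_row => k.
  pose y w' := row_mx (Psi w') (Psi w).
  have yc : {for w, continuous y}.
    apply: (continuous_of_lipschitz_at c0).
    apply: filterS (nearw _ we) => w' we'.
    apply: le_trans (Psi_lip _ _ we' we).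
    apply/mx_norm_leP => // i l; rewrite !mxE; case: fintype.splitP => j _.
      by have := mx_entry_le_norm (Psi w' - Psi w) i j; rewrite !mxE.
    by rewrite subrr normr0.
  pose m (i : 'I_d) w' :=
    (peval (\det A) (y w'))^-1 * peval (\adj A (rshift q i) k) (y w').
  apply: (@differentiable_slope _ _ _ m) => [i|].
    apply: continuousM.
      apply: continuousV; last first.
        by apply: continuous_comp yc _; exact: continuous_peval.
      apply: unit_peval_det; have [wr _] := PsiP _ we.
      by have [] := inj _ _ wr wr.
    by apply: continuous_comp yc _; exact: continuous_peval.
  apply: filterS (nearw _ we) => w' we'.
  have [wr Gw] := PsiP _ we; have [wr' Gw'] := PsiP _ we'.
  have [uA _] := inj _ _ wr' wr.
  have := cramer_slope k uA (GA _ _); rewrite Gw Gw' embB !mxE => ->.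
  rewrite big_split_ord/= big1 ?add0r => [|j _]; last first.
    by rewrite row_mxEl mxE mul0r.
  by apply: eq_bigr => i _; rewrite row_mxEr; congr (_ * _); rewrite !mxE.
have Phip : Phi p = 0 by apply/rowP => i; rewrite !mxE.
have nearp : \forall z \near p, `|z - p| < r /\ `|Phi z| < e.
  have near_p : \forall z \near p, `|z - p| < r.
    by apply: near_norm_lt; rewrite subrr normr0.
  have dPhi : differentiable Phi p by exact: differentiable_peval_row.
  have /cvgrPdist_lt/(_ _ e0) := differentiable_continuous dPhi.
  rewrite Phip; apply: filterS2 near_p => z zr.
  by rewrite sub0r normrN.
pose Y z := row_mx (Psi (Phi z)) z.
exists Psi, (fun j k z =>
  - ((peval (\det A) (Y z))^-1 * peval (\adj A (lshift d j) k) (Y z))).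
split.
- have [wr Gw] := PsiP 0 ltac:(by rewrite normr0).
  have [_] := inj (Psi 0) p wr ltac:(by rewrite subrr normr0).
  rewrite Gw Gp row_mx0 subrr normr0 mulr0 normr_le0 subr_eq0.
  by move/eqP.
- by apply: filterS near0 => w; exact: Psi_diff.
- apply: filterS near0 => w /PsiP[_ Gw]; split=> [j|].
    have /rowP/(_ (lshift d j)) := Gw.
    by rewrite !row_mxEl !mxE.
  have /rowP GwE := Gw.
  by apply/rowP => i; have := GwE (rshift q i); rewrite !row_mxEr !mxE.
- move=> j k; apply: filterS nearp => z [zr ze].
  have Yd l : differentiable (fun z => Y z ord0 l) z.
    rewrite /Y; under eq_fun do rewrite mxE.
    case: fintype.splitP => i _; last exact: differentiable_coord.
    have -> : (fun z => Psi (Phi z) ord0 i)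
      = (fun w : 'rV[R[i]]_(q + d) => w ord0 i) \o (Psi \o Phi) by [].
    apply: differentiable_comp; last exact: differentiable_coord.
    apply: differentiable_comp; first exact: differentiable_peval_row.
    exact: Psi_diff.
  have [wr _] := PsiP _ ze.
  apply: differentiableN.
  apply: differentiableM; last exact: differentiable_peval.
  apply: differentiableV; first exact: differentiable_peval.
  by apply: unit_peval_det; have [] := inj _ _ wr zr.
- apply: filterS nearp => z [zr ze] k.
  have [wr Gw] := PsiP _ ze; have [uA _] := inj _ _ wr zr.
  have := cramer_slope k uA (GA _ _); rewrite Gw !mxE => ->.
  rewrite big_split_ord/= [X in _ + X]big1 ?addr0 => [|i _]; last first.
    by rewrite !mxE !(unsplitK (inr _)) subrr mul0r.
  apply: eq_bigr => j _; rewrite !mxE !(unsplitK (inl _)) !mxE sub0r.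
  by rewrite mulrC mulrN mulNr.
Qed.

End AnalyticSection.

Lemma analytic_section_of_dim (R : realType) (N q d : nat) (N_eq : N = (q + d)%N)
    (g : 'I_q -> mpoly N R[i]) (b : 'I_d -> mpoly N R[i]) (p : 'rV[R[i]]_N) :
    (forall j, peval (g j) p = 0) -> (forall i, peval (b i) p = 0) ->
    (forall v : 'rV[R[i]]_N,
      (forall j, \sum_k v ord0 k * peval (mderiv k (g j)) p = 0) ->
      (forall i, \sum_k v ord0 k * peval (mderiv k (b i)) p = 0) -> v = 0) ->
  let Phi (z : 'rV[R[i]]_N) : 'rV[R[i]]_d := \row_i peval (b i) z in
  exists (Psi : 'rV[R[i]]_d -> 'rV[R[i]]_N)
         (h : 'I_q -> 'I_N -> 'rV[R[i]]_N -> R[i]),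
  [/\ Psi 0 = p, holomorphic_near 0 Psi,
      \forall w \near (0 : 'rV[R[i]]_d),
        (forall j, peval (g j) (Psi w) = 0) /\ Phi (Psi w) = w,
      forall j k, holomorphic_near p (h j k)
    & \forall z \near p, forall k,
        Psi (Phi z) ord0 k - z ord0 k = \sum_j h j k z * peval (g j) z].
Proof. by subst N => gp bp jac Phi; exact: analytic_section. Qed.

(** * Polynomials to first order *)

Section FirstOrder.
Variable K : comNzRingType.
Implicit Types s t u : {poly K}.

(** Congruence modulo 'X^2. The quotient ring of dual numbers is kept implicit:
a tangent vector is a curve taken up to this congruence. *)
Definition eq_order1 s t := s`_0 = t`_0 /\ s`_1 = t`_1.

Lemma eq_order1_refl s : eq_order1 s s. Proof. by []. Qed.

Lemma eq_order1_sym s t : eq_order1 s t -> eq_order1 t s.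
Proof. by case. Qed.

Lemma eq_order1_trans t s u : eq_order1 s t -> eq_order1 t u -> eq_order1 s u.
Proof. by move=> [s0 s1] [t0 t1]; split; rewrite ?s0 ?s1. Qed.

Lemma coef1M s t : (s * t)`_1 = s`_0 * t`_1 + s`_1 * t`_0.
Proof. by rewrite coefM !big_ord_recl big_ord0 addr0. Qed.

Lemma eq_order1D s s' t t' :
  eq_order1 s s' -> eq_order1 t t' -> eq_order1 (s + t) (s' + t').
Proof. by move=> [s0 s1] [t0 t1]; split; rewrite !coefD ?s0 ?s1 ?t0 ?t1. Qed.

Lemma eq_order1M s s' t t' :
  eq_order1 s s' -> eq_order1 t t' -> eq_order1 (s * t) (s' * t').
Proof.
by move=> [s0 s1] [t0 t1]; split; rewrite ?coef0M ?coef1M ?s0 ?s1 ?t0 ?t1.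
Qed.

End FirstOrder.

Section FirstOrderField.
Variable K : fieldType.
Implicit Types s t u : {poly K}.

Lemma eq_order1_mulIr u s t : u`_0 != 0 ->
  eq_order1 (s * u) (t * u) -> eq_order1 s t.
Proof.
move=> u0; rewrite /eq_order1 !coef0M !coef1M => -[/(mulIf u0) st0].
by rewrite st0 => /addrI/(mulIf u0) ->.
Qed.

Lemma eq_order1_quotient s u : u`_0 != 0 -> exists t, eq_order1 (t * u) s.
Proof.
move=> u0; pose a := s`_0 / u`_0.
exists (a%:P + ((s`_1 - a * u`_1) / u`_0) *: 'X).
rewrite /eq_order1 coef0M coef1M !coefD !coefC !coefZ !coefX/=.
by rewrite !mulr0 mulr1 addr0 add0r /a !divfK// addrC subrK.
Qed.

End FirstOrderField.

Section FirstOrderMatrices.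
Variable K : comNzRingType.

Lemma eq_order1_sum (I : Type) (s : seq I) (F G : I -> {poly K}) :
  (forall i, eq_order1 (F i) (G i)) ->
  eq_order1 (\sum_(i <- s) F i) (\sum_(i <- s) G i).
Proof.
move=> FG; elim: s => [|i s IH]; first by rewrite !big_nil.
by rewrite !big_cons; exact: eq_order1D.
Qed.

Lemma eq_order1_sum0 (I : Type) (s : seq I) (F : I -> {poly K}) :
  (forall i, eq_order1 (F i) 0) -> eq_order1 (\sum_(i <- s) F i) 0.
Proof.
move=> F0; have := eq_order1_sum s F0.
by rewrite [X in eq_order1 _ X]big1.
Qed.

Definition eq_order1_mx m n (A B : 'M[{poly K}]_(m, n)) :=
  forall i j, eq_order1 (A i j) (B i j).

Lemma eq_order1_mulmx m n p (A A' : 'M[{poly K}]_(m, n))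
    (B B' : 'M[{poly K}]_(n, p)) :
  eq_order1_mx A A' -> eq_order1_mx B B' -> eq_order1_mx (A *m B) (A' *m B').
Proof.
move=> AA BB i j; rewrite !mxE; apply: eq_order1_sum => k.
exact: eq_order1M.
Qed.

Lemma coef0_mulmx m n p (A : 'M[{poly K}]_(m, n)) (B : 'M[{poly K}]_(n, p)) i j :
  ((A *m B) i j)`_0 = \sum_k (A i k)`_0 * (B k j)`_0.
Proof. by rewrite mxE coef_sum; apply: eq_bigr => k _; rewrite coef0M. Qed.

Lemma coef1_mulmx m n p (A : 'M[{poly K}]_(m, n)) (B : 'M[{poly K}]_(n, p)) i j :
  ((A *m B) i j)`_1 = \sum_k ((A i k)`_0 * (B k j)`_1 + (A i k)`_1 * (B k j)`_0).
Proof. by rewrite mxE coef_sum; apply: eq_bigr => k _; rewrite coef1M. Qed.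

Lemma mulmx_eq_order1_0 m n p (A : 'M[{poly K}]_(m, n))
    (B : 'M[{poly K}]_(n, p)) :
  (forall i k, (A i k)`_0 = 0) -> (forall k j, (B k j)`_0 = 0) ->
  eq_order1_mx (A *m B) 0.
Proof.
move=> A0 B0 i j; split; rewrite [in RHS]mxE coef0.
  by rewrite coef0_mulmx big1// => k _; rewrite A0 mul0r.
rewrite coef1_mulmx big1// => k _.
by rewrite A0 B0 mul0r mulr0 addr0.
Qed.

End FirstOrderMatrices.

Section PolynomialCurves.
Variable R : realType.

Definition along N (t : 'I_N -> {poly R[i]}) : mpoly N R[i] -> {poly R[i]} :=
  mmap polyC t.

Section Along.
Variables (N : nat) (t : 'I_N -> {poly R[i]}).
Implicit Types P Q : mpoly N R[i].

Lemma alongC c : along t (mpolyC N c) = c%:P. Proof. exact: mmapC. Qed.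

Lemma alongX i : along t (mpolyX R[i] (mnm1 i)) = t i.
Proof. by rewrite /along mmapX mmap1U. Qed.

Lemma alongD P Q : along t (P + Q) = along t P + along t Q.
Proof. exact: mmapD. Qed.

Lemma alongM P Q : along t (P * Q) = along t P * along t Q.
Proof. exact: (rmorphM (mmap polyC t)). Qed.

Lemma along_taylor P (z : 'rV[R[i]]_N) : (forall k, z ord0 k = (t k)`_0) ->
  (along t P)`_0 = peval P z /\
  (along t P)`_1 = \sum_k (t k)`_1 * peval (mderiv k P) z.
Proof.
move=> zt; elim/mpoly_ring_ind: P =>
  [c|j|P Q [P0 P1] [Q0 Q1]|P Q [P0 P1] [Q0 Q1]].
- rewrite alongC !coefC/= pevalC; split=> //.
  by rewrite big1// => k _; rewrite mderivC peval0 mulr0.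
- rewrite alongX pevalX zt; split=> //.
  rewrite (bigD1 j)//= big1 ?addr0 => [|k kj].
    by rewrite peval_mderivX eqxx mulr1.
  by rewrite peval_mderivX (negbTE kj) mulr0.
- rewrite alongD !coefD P0 P1 Q0 Q1 pevalD; split; first exact: erefl.
  by rewrite -big_split/=; apply: eq_bigr => k _; rewrite mderivD pevalD mulrDr.
- rewrite alongM coef0M coef1M P0 P1 Q0 Q1 pevalM; split; first exact: erefl.
  rewrite mulr_sumr mulr_suml -big_split/=; apply: eq_bigr => k _.
  rewrite mderivM pevalD !pevalM.
  move: (peval P z) (peval Q z) (peval (mderiv k P) z).
  move: (peval (mderiv k Q) z) (t k)`_1.
  by move=> b' v a b a'; ring.
Qed.

End Along.
End PolynomialCurves.

(** * Zariski neighbourhoods seen in a chart *)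

Section Neighbourhoods.
Variables (R : realType) (M : prevariety R) (c : chart M) (x : M).
Hypothesis cx : chart_dom c x.

(** P holds on a principal neighbourhood of x in the chart c. In a fixed chart
such neighbourhoods are stable under intersection by taking the product of
their equations; [near_in_open] compares them with the open sets. *)
Definition near_in (P : M -> Prop) : Prop :=
  exists Q : mpoly (chart_dim c) R[i], peval Q (coord c x) != 0 /\
    forall y, chart_dom c y -> peval Q (coord c y) != 0 -> P y.

Lemma near_in_at P : near_in P -> P x.
Proof. by case=> Q [Qx]; exact. Qed.

Lemma near_inS (P P' : M -> Prop) :
  (forall y, P y -> P' y) -> near_in P -> near_in P'.
Proof. by move=> PP' [Q [Qx QP]]; exists Q; split=> // y cy Qy; exact/PP'/QP. Qed.

Lemma near_inS2 (P1 P2 P : M -> Prop) : (forall y, P1 y -> P2 y -> P y) ->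
  near_in P1 -> near_in P2 -> near_in P.
Proof.
move=> PP [Q1 [Q1x P1Q]] [Q2 [Q2x P2Q]]; exists (Q1 * Q2); split.
  by rewrite pevalM mulf_neq0.
move=> y cy; rewrite pevalM mulf_eq0 negb_or => /andP[Q1y Q2y].
by apply: PP; [exact: P1Q | exact: P2Q].
Qed.

Lemma near_inT (P : M -> Prop) : (forall y, P y) -> near_in P.
Proof. by move=> Py; exists 1; rewrite peval1 oner_eq0. Qed.

Lemma near_in_dom : near_in (fun y => chart_dom c y).
Proof. by exists 1; rewrite peval1 oner_eq0. Qed.

Lemma near_in_neq0 Q : peval Q (coord c x) != 0 ->
  near_in (fun y => peval Q (coord c y) != 0).
Proof. by move=> Qx; exists Q. Qed.

Lemma near_in_forall (T : finType) (P : T -> M -> Prop) :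
  (forall t, near_in (P t)) -> near_in (fun y => forall t, P t y).
Proof.
move=> nP; suff: near_in (fun y => forall t, t \in enum T -> P t y).
  by apply: near_inS => y Py t; apply: Py; rewrite mem_enum.
elim: (enum T) => [|t s IH]; first exact: near_inT.
apply: near_inS2 IH (nP t) => y Ps Pt u; rewrite inE => /predU1P[->//|].
exact: Ps.
Qed.

Lemma near_in_open_set (P : M -> Prop) : near_in P ->
  exists U : set M, [/\ zariski_open U, U x & forall y, U y -> P y].
Proof.
move=> [Q [Qx QP]]; exists [set y | chart_dom c y /\ peval Q (coord c y) != 0].
split=> //= [y [cy Qy]|y [cy Qy]]; last exact: QP.
by exists c, Q; split.
Qed.

End Neighbourhoods.

Lemma clear_denominators (R : realType) (N L : nat) (F : mpoly L R[i])
    (P : 'I_L -> mpoly N R[i]) (Q : mpoly N R[i]) :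
  exists (G : mpoly N R[i]) (m : nat), forall z (w : 'rV[R[i]]_L),
    peval Q z != 0 -> (forall k, w ord0 k = peval (P k) z / peval Q z) ->
    peval F w * peval Q z ^+ m = peval G z.
Proof.
elim/mpoly_ring_ind: F =>
  [c|k|F F' [G [m FG]] [G' [m' FG']]|F F' [G [m FG]] [G' [m' FG']]].
- by exists (mpolyC _ c), 0 => z w _ _; rewrite !pevalC mulr1.
- by exists (P k), 1 => z w Qz wz; rewrite pevalX wz expr1 divfK.
- exists (G * Q ^+ m' + G' * Q ^+ m), (m + m')%N => z w Qz wz.
  rewrite !pevalD !pevalM -(FG z w)// -(FG' z w)//.
  by rewrite /peval !rmorphXn/= exprD; ring.
- exists (G * G'), (m + m')%N => z w Qz wz.
  by rewrite !pevalM -(FG z w)// -(FG' z w)// exprD; ring.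
Qed.

(** The change of charts is a fraction of polynomials, and clearing its
denominators turns an equation of the complement in any other chart into one
in the chart c. *)
Lemma near_in_open (R : realType) (M : prevariety R) (c : chart M) (x : M)
    (U : set M) :
  chart_dom c x -> zariski_open U -> U x -> near_in c x U.
Proof.
move=> cx /(_ x)/[apply] -[c' [Q [c'x Qx QU]]].
have [Q1 [P [Q1x compat]]] := chart_compat cx c'x.
have [G [m GE]] := clear_denominators Q P Q1.
exists (Q1 * G); split.
  have [_ ?] := compat _ cx Q1x.
  by rewrite pevalM mulf_neq0// -(GE _ (coord c' x))// mulf_neq0// expf_neq0.
move=> y cy; rewrite pevalM mulf_eq0 negb_or => /andP[Q1y Gy].
have [c'y yE] := compat _ cy Q1y; apply: QU => //.
by move: Gy; rewrite -(GE _ (coord c' y))// mulf_eq0 negb_or => /andP[].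
Qed.

(** * Determinants and rank *)

Lemma det_mulmx_thin (K : comNzRingType) n r (A : 'M[K]_(n, r)) (B : 'M[K]_(r, n)) :
  (r < n)%N -> \det (A *m B) = 0.
Proof.
move=> rn; have: (0 < n - r)%N by rewrite subn_gt0.
move: A B; rewrite -(subnKC (ltnW rn)) addKn; move: (n - r)%N => k A B k0.
rewrite -[A *m B]addr0 -(mul0mx _ (0 : 'M[K]_(k, _))) -mul_row_col det_mulmx.
rewrite (expand_det_col _ (rshift r (Ordinal k0))) big1 ?mul0r// => i _.
by rewrite row_mxEr mxE mul0r.
Qed.

(** The Schur complement of D, with denominators cleared so that it exists over
any commutative ring. *)
Lemma schur_det (K : comNzRingType) m r (A : 'M[K]_m) (X : 'M[K]_(m, r))
    (Y : 'M[K]_(r, m)) (D : 'M[K]_r) :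
  \det D ^+ m * \det (block_mx A X Y D)
    = \det D * \det (\det D *: A - X *m \adj D *m Y).
Proof.
pose B := \det D *: A - X *m \adj D *m Y.
have : block_mx (\det D)%:M (- (X *m \adj D)) 0 1%:M *m block_mx A X Y D
     = block_mx B 0 Y D.
  rewrite mulmx_block !mul0mx !mul1mx !add0r !mul_scalar_mx !mulNmx.
  by rewrite -[X *m _ *m D]mulmxA mul_adj_mx mul_mx_scalar subrr.
move=> /(congr1 determinant); rewrite det_mulmx det_ublock det_lblock.
by rewrite det_scalar det1 mulr1 mulrC => ->; rewrite mulrC.
Qed.

Lemma rank_equivalence (F : fieldType) m (S S' : 'M[F]_m) : \rank S = \rank S' ->
  exists L T : 'M[F]_m, [/\ L \in unitmx, T \in unitmx & L *m S *m T = S'].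
Proof.
move=> rk.
exists (col_ebase S' *m invmx (col_ebase S)),
  (invmx (row_ebase S) *m row_ebase S').
split; rewrite ?unitmx_mul ?unitmx_inv ?col_ebase_unit ?row_ebase_unit//.
rewrite -{2}(mulmx_ebase S) !mulmxA mulmxKV ?col_ebase_unit//.
by rewrite mulmxK ?row_ebase_unit// rk mulmx_ebase.
Qed.

Lemma det_mx2 (K : comNzRingType) (A : 'M[K]_2) :
  \det A = A ord0 ord0 * A ord_max ord_max - A ord0 ord_max * A ord_max ord0.
Proof.
rewrite (expand_det_row _ ord0) !big_ord_recl big_ord0 addr0 /cofactor !det_mx11.
rewrite !mxE /= expr0 expr1 mul1r mulN1r mulrN.
by congr (_ * A _ _ - A _ _ * A _ _); apply: val_inj.
Qed.

Lemma det_mxsub_square (K : comNzRingType) m (t1 t2 : 'I_m -> 'I_m)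
    (A : 'M[K]_m) :
  \det (mxsub t1 t2 A) = \det (rowsub t1 1%:M) * \det A * \det (colsub t2 1%:M).
Proof.
rewrite -{1}[A]mulmx1 -{1}[A]mul1mx mxsub_mul -[rowsub t1 (_ *m _)]mul_rowsub_mx.
by rewrite !det_mulmx.
Qed.

(** * Regular germs and their jets along a tangent vector *)

Section RegularGerms.
Variables (R : realType) (M : prevariety R) (c : chart M) (x : M).
Hypothesis cx : chart_dom c x.
Notation p := (coord c x).
Implicit Types (f : M -> R[i]) (P Q : mpoly (chart_dim c) R[i]).

Definition represents P Q f : Prop :=
  peval Q p != 0 /\
  near_in c x (fun y => f y * peval Q (coord c y) = peval P (coord c y)).

Definition regular_in f : Prop := exists P Q, represents P Q f.

Lemma represents_poly P : represents P 1 (fun y => peval P (coord c y)).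
Proof.
split; first by rewrite peval1 oner_eq0.
by apply: near_inT => y; rewrite peval1 mulr1.
Qed.

Lemma represents_near f f' P Q :
  near_in c x (fun y => f' y = f y) -> represents P Q f -> represents P Q f'.
Proof. by move=> ff [Qx fE]; split=> //; apply: near_inS2 ff fE => y ->. Qed.

Lemma representsD f f' P P' Q Q' : represents P Q f -> represents P' Q' f' ->
  represents (P * Q' + P' * Q) (Q * Q') (fun y => f y + f' y).
Proof.
move=> [Qx fE] [Qx' fE']; split; first by rewrite pevalM mulf_neq0.
by apply: near_inS2 fE fE' => y E E'; rewrite pevalD !pevalM -E -E'; ring.
Qed.

Lemma representsM f f' P P' Q Q' : represents P Q f -> represents P' Q' f' ->
  represents (P * P') (Q * Q') (fun y => f y * f' y).
Proof.
move=> [Qx fE] [Qx' fE']; split; first by rewrite pevalM mulf_neq0.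
by apply: near_inS2 fE fE' => y E E'; rewrite !pevalM -E -E'; ring.
Qed.

Lemma regular_in_at f : regular_in f <-> regular_at x f.
Proof.
split=> [[P [Q [Qx [Q0 [Q0x fE]]]]]|[c' [P [Q [c'x Qx fE]]]]].
  exists c, (P * Q0), (Q * Q0); split=> //; first by rewrite pevalM mulf_neq0.
  move=> y cy; rewrite !pevalM mulf_eq0 negb_or => /andP[Qy Q0y].
  by rewrite -(fE y cy Q0y) -mulf_div divff// mulr1 mulfK.
have [Q1 [P1 [Q1x compat]]] := chart_compat cx c'x.
have [GP [m PE]] := clear_denominators P P1 Q1.
have [GQ [m' QE]] := clear_denominators Q P1 Q1.
have open_c' :
    zariski_open [set y | chart_dom c' y /\ peval Q (coord c' y) != 0].
  by move=> y [c'y Qy]; exists c', Q; split.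
have near_c' := near_in_open cx open_c' (conj c'x Qx).
have [_ p'E] := compat _ cx Q1x.
exists (GP * Q1 ^+ m'), (GQ * Q1 ^+ m); split.
  have Q1E k z : peval (Q1 ^+ k) z = peval Q1 z ^+ k by exact: rmorphXn.
  by rewrite pevalM Q1E -(QE _ (coord c' x))// !mulf_neq0// expf_neq0.
have := near_inS2 (P := fun y => _) (fun y h h' => conj h h') near_c'
  (near_in_dom c x).
apply: near_inS2 (near_in_neq0 Q1x) => y Q1y [[c'y Qy] cy].
have [_ yE] := compat _ cy Q1y.
have Q1E k z : peval (Q1 ^+ k) z = peval Q1 z ^+ k by exact: rmorphXn.
rewrite fE// !pevalM !Q1E -(QE _ (coord c' y))// -(PE _ (coord c' y))//.
by field.
Qed.

Lemma regular_cst a : regular_in (fun=> a).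
Proof.
exists (mpolyC _ a), 1; have := represents_poly (mpolyC _ a).
by apply: represents_near; apply: near_inT => y; rewrite pevalC.
Qed.

Section Jets.
Variable v : 'rV[R[i]]_(chart_dim c).

(** The line p + 'X v in the affine space of the chart; when v is tangent to
the variety, it lies on the variety modulo 'X^2. *)
Definition tangent_curve (k : 'I_(chart_dim c)) : {poly R[i]} :=
  (p ord0 k)%:P + v ord0 k *: 'X.

Notation curve := (along tangent_curve).

Lemma curve_coef P : (curve P)`_0 = peval P p /\
  (curve P)`_1 = \sum_k v ord0 k * peval (mderiv k P) p.
Proof.
have c0 k : p ord0 k = (tangent_curve k)`_0.
  by rewrite coefD coefC coefZ coefX mulr0 addr0.
have [-> ->] := along_taylor P c0; split; first exact: erefl.
apply: eq_bigr => k _; congr (_ * _).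
by rewrite coefD coefC coefZ coefX mulr1 add0r.
Qed.

(** u is the restriction to the curve of a fraction P / Q that represents f,
that is, f(p) + 'X df(v). The relation becomes single-valued, modulo 'X^2,
only for tangent v. *)
Definition jet f u : Prop :=
  exists P Q, represents P Q f /\ eq_order1 (u * curve Q) (curve P).

Lemma jet_poly P : jet (fun y => peval P (coord c y)) (curve P).
Proof.
exists P, 1; split; first exact: represents_poly.
by rewrite [curve 1](rmorph1 (mmap polyC _)) mulr1.
Qed.

Lemma jet_cst a : jet (fun=> a) a%:P.
Proof.
have := jet_poly (mpolyC _ a); rewrite alongC.
by under eq_fun do rewrite pevalC.
Qed.

Lemma jet_near f f' u u' : near_in c x (fun y => f' y = f y) -> eq_order1 u' u ->
  jet f u -> jet f' u'.
Proof.
move=> ff uu [P [Q [rep uE]]]; exists P, Q; split.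
  exact: represents_near rep.
exact: eq_order1_trans (eq_order1M uu (eq_order1_refl _)) uE.
Qed.

Lemma jetD f f' u u' : jet f u -> jet f' u' -> jet (fun y => f y + f' y) (u + u').
Proof.
move=> [P [Q [rep uE]]] [P' [Q' [rep' uE']]].
eexists; eexists; split; first exact: representsD rep rep'.
rewrite alongD !alongM mulrDl !mulrA [u' * _]mulrC -[_ * u' * _]mulrA.
rewrite [curve P' * _]mulrC.
by apply: eq_order1D; apply: eq_order1M.
Qed.

Lemma jetM f f' u u' : jet f u -> jet f' u' -> jet (fun y => f y * f' y) (u * u').
Proof.
move=> [P [Q [rep uE]]] [P' [Q' [rep' uE']]].
eexists; eexists; split; first exact: representsM rep rep'.
by rewrite !alongM mulrACA; exact: eq_order1M.
Qed.

Lemma jet_sum (I : Type) (s : seq I) (F : I -> M -> R[i])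
    (U : I -> {poly R[i]}) :
  (forall t, jet (F t) (U t)) ->
  jet (fun y => \sum_(t <- s) F t y) (\sum_(t <- s) U t).
Proof.
move=> FU; elim: s => [|t s IH].
  by under eq_fun do rewrite big_nil; rewrite big_nil; exact: (jet_cst 0).
by under eq_fun do rewrite big_cons; rewrite big_cons; exact: jetD.
Qed.

Lemma jet_prod (I : Type) (s : seq I) (F : I -> M -> R[i])
    (U : I -> {poly R[i]}) :
  (forall t, jet (F t) (U t)) ->
  jet (fun y => \prod_(t <- s) F t y) (\prod_(t <- s) U t).
Proof.
move=> FU; elim: s => [|t s IH].
  by under eq_fun do rewrite big_nil; rewrite big_nil; exact: (jet_cst 1).
by under eq_fun do rewrite big_cons; rewrite big_cons; exact: jetM.
Qed.

Definition jet_mx m n (S : M -> 'M[R[i]]_(m, n)) (U : 'M[{poly R[i]}]_(m, n)) :=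
  forall k l, jet (fun y => S y k l) (U k l).

Lemma jet_mulmx m n q (S : M -> 'M[R[i]]_(m, n)) (T : M -> 'M[R[i]]_(n, q)) U V :
  jet_mx S U -> jet_mx T V -> jet_mx (fun y => S y *m T y) (U *m V).
Proof.
move=> SU TV k l; under eq_fun do rewrite mxE; rewrite mxE.
by apply: jet_sum => j; exact: jetM.
Qed.

Lemma jet_det m (S : M -> 'M[R[i]]_m) U :
  jet_mx S U -> jet (fun y => \det (S y)) (\det U).
Proof.
move=> SU; rewrite /determinant; apply: jet_sum => s.
apply: jetM; last by apply: jet_prod => k; exact: SU.
move: (perm.odd_perm s) => odd_s.
rewrite (_ : (-1) ^+ odd_s = ((-1) ^+ odd_s : R[i])%:P); first exact: jet_cst.
by rewrite rmorphXn rmorphN1.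
Qed.

Lemma regular_jet f : regular_in f -> exists u, jet f u.
Proof.
move=> [P [Q rep]]; have [u uE] : exists u, eq_order1 (u * curve Q) (curve P).
  by apply: eq_order1_quotient; rewrite (curve_coef Q).1; exact: rep.1.
by exists u, P, Q.
Qed.

End Jets.
End RegularGerms.

Lemma eq_order1_subr0 (K : comNzRingType) (s t : {poly K}) :
  eq_order1 (s - t) 0 -> eq_order1 s t.
Proof. by rewrite /eq_order1 !coefB !coef0 => -[/subr0_eq-> /subr0_eq->]. Qed.

(** * Tangent vectors *)

Section TangentVectors.
Variables (R : realType) (M : prevariety R) (c : chart M) (x : M).
Hypothesis cx : chart_dom c x.
Notation p := (coord c x).
Variable v : 'rV[R[i]]_(chart_dim c).
Notation curve := (along (tangent_curve x v)).

(** v is a Zariski tangent vector: the differentials at x of all polynomials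
vanishing on the variety near x kill v. *)
Definition tangent_to : Prop := forall P : mpoly (chart_dim c) R[i],
  near_in c x (fun y => peval P (coord c y) = 0) -> eq_order1 (curve P) 0.

Lemma tangent_to_equations q (g : 'I_q -> mpoly (chart_dim c) R[i]) :
    (forall P, near_in c x (fun y => peval P (coord c y) = 0) ->
      exists Q (h : 'I_q -> mpoly (chart_dim c) R[i]),
        peval Q p != 0 /\ Q * P = \sum_j h j * g j) ->
    (forall j, peval (g j) p = 0) ->
    (forall j, \sum_k v ord0 k * peval (mderiv k (g j)) p = 0) ->
  tangent_to.
Proof.
move=> g_gen gp dg P /g_gen[Q [h [Qx QP]]].
have c0 := curve_coef x v.
apply: (@eq_order1_mulIr _ (curve Q)); first by rewrite (c0 Q).1.
rewrite mul0r mulrC -alongM QP [curve _](rmorph_sum (mmap polyC _)).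
apply: eq_order1_sum0 => j.
suff: eq_order1 (curve (h j) * curve (g j)) 0 by rewrite -alongM.
rewrite -[X in eq_order1 _ X](mulr0 (curve (h j))).
apply: eq_order1M => //; split; rewrite coef0.
  by rewrite (c0 _).1.
by rewrite (c0 _).2.
Qed.

Lemma jet_unique f u u' :
  tangent_to -> jet x v f u -> jet x v f u' -> eq_order1 u u'.
Proof.
move=> tv [P [Q [[Qx fE] uE]]] [P' [Q' [[Qx' fE'] uE']]].
have /tv : near_in c x (fun y => peval (P * Q' - P' * Q) (coord c y) = 0).
  by apply: near_inS2 fE fE' => y E E'; rewrite pevalB !pevalM -E -E'; ring.
rewrite [curve _]mmapB -!/(curve _) !alongM => /eq_order1_subr0 PP.
have c0 := curve_coef x v.
apply: (@eq_order1_mulIr _ (curve Q * curve Q')).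
  by rewrite coef0M !(c0 _).1 mulf_neq0.
rewrite !mulrA; apply: eq_order1_trans (_ : eq_order1 (curve P * curve Q') _).
  exact: eq_order1M.
apply: eq_order1_trans PP _.
rewrite -[u' * _ * _]mulrA [curve Q * _]mulrC mulrA.
exact: eq_order1M (eq_order1_sym _) _.
Qed.

Lemma jet_at f u : jet x v f u -> u`_0 = f x.
Proof.
have c0 := curve_coef x v.
move=> [P [Q [[Qx /(near_in_at cx) fE]]]] [uE _].
by apply: (mulIf Qx); rewrite fE -(c0 P).1 -uE coef0M (c0 Q).1.
Qed.

Lemma jet_along N (phi : M -> 'rV[R[i]]_N) (t : 'I_N -> {poly R[i]}) F :
  (forall k, jet x v (fun y => phi y ord0 k) (t k)) ->
  jet x v (fun y => peval F (phi y)) (along t F).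
Proof.
move=> phit; elim/mpoly_ring_ind: F => [a|k|P Q jP jQ|P Q jP jQ].
- by under eq_fun do rewrite pevalC; rewrite alongC; exact: jet_cst.
- by under eq_fun do rewrite pevalX; rewrite alongX; exact: phit.
- by under eq_fun do rewrite pevalD; rewrite alongD; exact: jetD.
- by under eq_fun do rewrite pevalM; rewrite alongM; exact: jetM.
Qed.

Lemma regular_coord (d : chart M) k : chart_dom d x ->
  regular_in c x (fun y => coord d y ord0 k).
Proof.
move=> dx; have [Q [P [Qx compat]]] := chart_compat cx dx.
exists (P k), Q; split=> //; exists Q; split=> // y cy Qy.
by have [_ ->] := compat y cy Qy; rewrite divfK.
Qed.

(** The F_j live in a chart d that may differ from c. As their jets vanish and
their differentials span the cotangent space of the chart d, the coordinates
of d have constant jets along v. The coordinates of c are fractions in those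
of d, so their jets are constant too, and v is the derivative of these. *)
Lemma vanishing_jets_tangent0 (d : chart M) s
    (F : 'I_s -> mpoly (chart_dim d) R[i]) :
    chart_dom d x -> tangent_to ->
    (forall j, jet x v (fun y => peval (F j) (coord d y)) 0) ->
    \rank (\matrix_(j < s, k < chart_dim d) peval (mderiv k (F j)) (coord d x))
      = chart_dim d ->
  v = 0.
Proof.
move=> dx tv F0 rkF.
have [t tP] := choice (fun k => regular_jet v (regular_coord k dx)).
have t0 k : coord d x ord0 k = (t k)`_0 by rewrite (jet_at (tP k)).
have t1 k : (t k)`_1 = 0.
  have /row_fullP[B BJ] : row_full (\matrix_(j < s, k < chart_dim d)
      peval (mderiv k (F j)) (coord d x)).
    by rewrite /row_full rkF.
  pose w : 'cV[R[i]]_(chart_dim d) := \col_k (t k)`_1.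
  suff : w = 0 by move=> /colP/(_ k); rewrite !mxE.
  rewrite -[w]mul1mx -BJ -mulmxA (_ : _ *m w = 0) ?mulmx0//.
  apply/colP => j; rewrite !mxE.
  have [_] := jet_unique tv (jet_along (F j) tP) (F0 j).
  rewrite coef0 (along_taylor (F j) t0).2; apply: etrans.
  by apply: eq_bigr => l _; rewrite !mxE mulrC.
have along1 P : (along t P)`_1 = 0.
  by rewrite (along_taylor P t0).2 big1// => k _; rewrite t1 mul0r.
have [Q [P [Qx compat]]] := chart_compat dx cx.
have near_d : near_in c x [set y | chart_dom d y /\ peval Q (coord d y) != 0].
  by apply: near_in_open => // y [dy Qy]; exists d, Q; split.
apply/rowP => k; rewrite mxE.
have jk : jet x v (fun y => peval (P k) (coord d y))
    (curve (mpolyX _ (mnm1 k)) * along t Q).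
  apply: jet_near
    (jetM (jet_poly x v (mpolyX _ (mnm1 k))) (jet_along Q tP)).
    apply: near_inS near_d => y [dy Qy].
    by rewrite pevalX; have [_ ->] := compat y dy Qy; rewrite divfK.
  exact: eq_order1_refl.
have [_] := jet_unique tv jk (jet_along (P k) tP).
rewrite coef1M !along1 mulr0 add0r (along_taylor Q t0).1 alongX.
rewrite coefD coefC coefZ coefX mulr1 add0r => /eqP.
by rewrite mulf_eq0 (negbTE Qx) orbF => /eqP.
Qed.

End TangentVectors.

(** * Local structure where the rank drops by two *)

Section CorankTwo.
Variables (R : realType) (M : prevariety R) (c : chart M) (x : M).
Hypothesis cx : chart_dom c x.
Notation p := (coord c x).

Lemma regular_mx_common_denominator m n (S : M -> 'M[R[i]]_(m, n)) :
  (forall k l, regular_in c x (fun y => S y k l)) ->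
  exists (P : 'M[mpoly (chart_dim c) R[i]]_(m, n)) (Q : mpoly (chart_dim c) R[i]),
    peval Q p != 0 /\
    near_in c x (fun y => mxpeval P (coord c y) = peval Q (coord c y) *: S y).
Proof.
move=> regS.
have /choice[P /choice[Q rep]] : forall kl : 'I_m * 'I_n, exists P Q,
  @represents R M c x P Q (fun y => S y kl.1 kl.2) by move=> kl; exact: regS.
exists (\matrix_(k, l) (P (k, l) * \prod_(kl | kl != (k, l)) Q kl)),
  (\prod_kl Q kl).
have prodE (s : pred ('I_m * 'I_n)) z :
    peval (\prod_(kl | s kl) Q kl) z = \prod_(kl | s kl) peval (Q kl) z.
  exact: (rmorph_prod (meval _)).
split; first by rewrite prodE; apply/prodf_neq0 => kl _; exact: (rep kl).1.
have := near_in_forall (fun kl => (rep kl).2).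
apply: near_inS => y SE; apply/matrixP => k l; rewrite !mxE pevalM.
rewrite !prodE [in RHS](bigD1 (k, l))//= -(SE (k, l))/=; ring.
Qed.

(** Constant row and column operations bring S(x) to the block form
diag(0, 1), with a zero block of size 2. In the transformed matrix
(K, X; Y, D), the matrix B is det(D) times the Schur complement of D, so
det(B) is a unit times det(S), and B has the same differential at x as K.
If v kills the entries of B then K vanishes along v modulo 'X^2; as X and Y
vanish at x, the transformed matrix is (X; D)(Y, 1) modulo 'X^2, and S
factors through dimension r to first order along v. *)
Lemma corank2_local_model r (S : M -> 'M[R[i]]_(2 + r)) :
    (forall k l, regular_in c x (fun y => S y k l)) -> \rank (S x) = r ->
  exists (B : 'M[mpoly (chart_dim c) R[i]]_2) (kappa : mpoly (chart_dim c) R[i]),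
  [/\ mxpeval B p = 0,
      peval kappa p != 0,
      near_in c x (fun y =>
        \det (mxpeval B (coord c y)) = peval kappa (coord c y) * \det (S y))
    & forall v : 'rV[R[i]]_(chart_dim c),
        (forall i j, \sum_k v ord0 k * peval (mderiv k (B i j)) p = 0) ->
        exists (A1 : 'M[{poly R[i]}]_(2 + r, r))
               (A2 : 'M[{poly R[i]}]_(r, 2 + r)),
          jet_mx x v S (A1 *m A2)].
Proof.
move=> regS rkS.
have [P [Q [Qx PE]]] := regular_mx_common_denominator regS.
have [L [T [Lu Tu LPT]]] : exists L T : 'M[R[i]]_(2 + r),
    [/\ L \in unitmx, T \in unitmx & L *m mxpeval P p *m T = copid_mx 2].
  apply: rank_equivalence; rewrite (near_in_at cx PE) rank_copid_mx ?leq_addr//.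
  by rewrite addKn eqmx_scale.
pose C m n (A : 'M[R[i]]_(m, n)) :=
  map_mx (mpolyC (chart_dim c) (R:=R[i])) A.
have CE m n (A : 'M[R[i]]_(m, n)) z : mxpeval (C m n A) z = A.
  by apply/matrixP => i j; rewrite !mxE pevalC.
pose W : 'M[mpoly (chart_dim c) R[i]]_(2 + r) := C _ _ L *m P *m C _ _ T.
have WE z : mxpeval W z = L *m mxpeval P z *m T by rewrite !peval_mulmx !CE.
pose K := ulsubmx W; pose X := ursubmx W.
pose Y := dlsubmx W; pose D := drsubmx W.
have Wp : block_mx (mxpeval K p) (mxpeval X p) (mxpeval Y p) (mxpeval D p)
  = block_mx 0 0 0 1%:M.
  rewrite -map_block_mx submxK WE LPT /copid_mx pid_mx_block scalar_mx_block.
  by rewrite opp_block_mx add_block_mx !oppr0 !addr0 subrr.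
have [Kp Xp Yp Dp] := eq_block_mx Wp.
pose B := \det D *: K - X *m \adj D *m Y.
have BE z : mxpeval B z = \det (mxpeval D z) *: mxpeval K z
    - mxpeval X z *m \adj (mxpeval D z) *m mxpeval Y z.
  rewrite -peval_adj -!peval_mulmx -peval_det.
  by apply/matrixP => i j; rewrite !mxE pevalB pevalM.
pose kappa := \det D * mpolyC _ (\det L * \det T) * Q ^+ (2 + r).
have detD z : peval (\det D) z = \det (mxpeval D z) by exact: peval_det.
have kappaE z : peval kappa z
    = \det (mxpeval D z) * (\det L * \det T) * peval Q z ^+ (2 + r).
  by rewrite /kappa (pevalM _ (Q ^+ _)) (pevalM (\det D)) pevalC pevalXn detD.
have Bp : mxpeval B p = 0 by rewrite BE Kp Xp scaler0 !mul0mx subrr.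
have Bp0 i j : peval (B i j) p = 0.
  transitivity (mxpeval B p i j); first by rewrite [RHS]mxE.
  by rewrite Bp mxE.
exists B, kappa; split=> //.
- rewrite kappaE Dp det1 mul1r mulf_neq0 ?expf_neq0//.
  by rewrite mulf_neq0// -unitfE -unitmxE.
- have detDp : peval (\det D) p != 0 by rewrite detD Dp det1 oner_neq0.
  apply: near_inS2 PE (near_in_neq0 detDp) => y PE; rewrite detD => Dy.
  have := schur_det (mxpeval K (coord c y)) (mxpeval X (coord c y))
    (mxpeval Y (coord c y)) (mxpeval D (coord c y)).
  rewrite -BE -map_block_mx submxK WE PE !det_mulmx detZ => sch.
  apply: (mulfI Dy); rewrite -sch kappaE.
  by ring.
move=> v dB.
have c0 := curve_coef x v.
pose E m n (A : 'M[mpoly (chart_dim c) R[i]]_(m, n)) : 'M[{poly R[i]}]_(m, n) :=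
  map_mx (along (tangent_curve x v)) A.
have E0 m n (A : 'M[mpoly (chart_dim c) R[i]]_(m, n)) k l :
    (E m n A k l)`_0 = mxpeval A p k l.
  by rewrite !mxE (c0 _).1.
have EM m n q (A : 'M[mpoly (chart_dim c) R[i]]_(m, n))
    (A' : 'M[mpoly (chart_dim c) R[i]]_(n, q)) :
  E _ _ (A *m A') = E _ _ A *m E _ _ A' by exact: (map_mxM (mmap polyC _)).
have X0 k l : (E _ _ X k l)`_0 = 0 by rewrite E0 Xp mxE.
have D0 k l : (E _ _ D k l)`_0 = (k == l)%:R by rewrite E0 Dp mxE.
have Y0 k l : (E _ _ Y k l)`_0 = 0 by rewrite E0 Yp mxE.
have z0 m n k l : (0 : 'M[{poly R[i]}]_(m, n)) k l = 0 by rewrite mxE.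
have K0 : eq_order1_mx (E _ _ K) 0.
  have EB i j : along (tangent_curve x v) (B i j) = \det (E _ _ D) * E _ _ K i j
      - (E _ _ X *m \adj (E _ _ D) *m E _ _ Y) i j.
    have -> : \det (E _ _ D) = along (tangent_curve x v) (\det D).
      exact: (det_map_mx (mmap polyC _)).
    have -> : \adj (E _ _ D) = E _ _ (\adj D).
      by apply/esym; exact: (map_mx_adj (mmap polyC _)).
    have -> : B i j = \det D * K i j - (X *m \adj D *m Y) i j by rewrite !mxE.
    by rewrite [LHS]mmapB -/(along _ _) alongM -!EM ![E _ _ _ i j]mxE.
  have XDY0 : eq_order1_mx (E _ _ X *m \adj (E _ _ D) *m E _ _ Y) 0.
    apply: mulmx_eq_order1_0 => // k l.
    by rewrite coef0_mulmx big1// => i _; rewrite X0 mul0r.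
  move=> i j; apply: (@eq_order1_mulIr _ (\det (E _ _ D))).
    rewrite (_ : \det (E _ _ D) = along (tangent_curve x v) (\det D)).
      by rewrite (c0 _).1 detD Dp det1 oner_neq0.
    exact: (det_map_mx (mmap polyC _)).
  rewrite z0 mul0r mulrC.
  have -> : \det (E _ _ D) * E _ _ K i j = along (tangent_curve x v) (B i j)
      + (E _ _ X *m \adj (E _ _ D) *m E _ _ Y) i j by rewrite EB subrK.
  rewrite -[X in eq_order1 _ X]addr0; apply: eq_order1D.
    split; rewrite coef0; first by rewrite (c0 _).1 Bp0.
    by rewrite (c0 _).2 dB.
  by have := XDY0 i j; rewrite z0.
(* X Y and D Y - Y vanish to first order. *)
have EW : eq_order1_mx (E _ _ W)
    (col_mx (E _ _ X) (E _ _ D) *m row_mx (E _ _ Y) 1%:M).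
  rewrite mul_col_row !mulmx1 -[W]submxK /E map_block_mx => k l.
  case: (split_ordP k) => k' ->; case: (split_ordP l) => l' ->.
  - rewrite !block_mxEul; apply: eq_order1_trans (K0 k' l') (eq_order1_sym _).
    exact: mulmx_eq_order1_0.
  - by rewrite !block_mxEur.
  - rewrite !block_mxEdl.
    split; first rewrite coef0_mulmx; last rewrite coef1_mulmx.
      by rewrite Y0 big1// => j _; rewrite Y0 mulr0.
    rewrite (bigD1 k')//= Y0 mulr0 addr0 big1 ?addr0 => [|j jk].
      by rewrite D0 eqxx mul1r.
    by rewrite Y0 mulr0 addr0 D0 eq_sym (negbTE jk) mul0r.
  - by rewrite !block_mxEdr.
pose Cp (A : 'M[R[i]]_(2 + r)) : 'M[{poly R[i]}]_(2 + r) := map_mx polyC A.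
have EC A : E _ _ (C _ _ A) = Cp A.
  by apply/matrixP => k l; rewrite !mxE alongC.
have CpM A A' : Cp A *m Cp A' = Cp (A *m A') by rewrite -map_mxM.
have EP : E _ _ P = Cp (invmx L) *m E _ _ W *m Cp (invmx T).
  rewrite !EM !EC !mulmxA CpM mulVmx// -!mulmxA CpM mulmxV//.
  by rewrite /Cp !map_mx1 mul1mx mulmx1.
have [w wQ] : exists w, eq_order1 (w * along (tangent_curve x v) Q) 1.
  by apply: eq_order1_quotient; rewrite (c0 _).1.
pose A1 := col_mx (E _ _ X) (E _ _ D); pose A2 := row_mx (E _ _ Y) 1%:M.
exists (w *: (Cp (invmx L) *m A1)), (A2 *m Cp (invmx T)) => k l.
exists (P k l), Q; split.
  split=> //; apply: near_inS PE => y /matrixP/(_ k l); rewrite !mxE mulrC.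
  by move=> ->.
rewrite -scalemxAl mulmxA -[_ *m A1 *m A2]mulmxA mxE mulrAC.
rewrite -[X in eq_order1 _ X]mul1r; apply: eq_order1M => //.
have -> : along (tangent_curve x v) (P k l) = E _ _ P k l by rewrite mxE.
rewrite EP; apply: eq_order1_mulmx => //; apply: eq_order1_mulmx => //.
by move=> i j; exact: eq_order1_sym.
Qed.

End CorankTwo.

(** * Recognizing a node *)

Section NodeGerm.
Variables (R : realType) (N q : nat).
Hypothesis N_eq : N = (q + 4)%N.
Variables (J : set (mpoly N R[i])) (p : 'rV[R[i]]_N).
Variables (g : 'I_q -> mpoly N R[i]) (B : 'M[mpoly N R[i]]_2).

(** The linear change of variables with
ad - bc = ((a+d)/2)^2 + (i(a-d)/2)^2 + (i(b+c)/2)^2 + ((b-c)/2)^2. *)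
Definition node_coordinate (i : 'I_4) : mpoly N R[i] :=
  [:: mpolyC N (2^-1) * (B ord0 ord0 + B ord_max ord_max);
      mpolyC N ('i%C / 2) * (B ord0 ord0 - B ord_max ord_max);
      mpolyC N ('i%C / 2) * (B ord0 ord_max + B ord_max ord0);
      mpolyC N (2^-1) * (B ord0 ord_max - B ord_max ord0)]`_i.

Let Phi (z : 'rV[R[i]]_N) : 'rV[R[i]]_4 := \row_i peval (node_coordinate i) z.

Lemma node_equation_coordinate z :
  peval (node_equation R) (Phi z) = peval (\det B) z.
Proof.
rewrite /node_equation !big_ord_recl big_ord0 addr0.
rewrite !pevalD !pevalXn !pevalX !mxE /node_coordinate /=.
rewrite det_mx2 [in RHS]pevalB !pevalM !pevalC !pevalB !pevalD.
move: (peval (B ord0 ord0) z) (peval (B ord0 ord_max) z) => a b.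
move: (peval (B ord_max ord0) z) (peval (B ord_max ord_max) z) => b' a'.
have ii : ('i%C : R[i]) ^+ 2 = -1 by exact: sqr_i.
by field: ii.
Qed.

Hypothesis gJ : forall j, J (g j).
Hypothesis detBJ : J (\det B).
Hypothesis gp : forall j, peval (g j) p = 0.
Hypothesis Bp : forall i j, peval (B i j) p = 0.
Hypothesis jacobian_free : forall v : 'rV[R[i]]_N,
  (forall j, \sum_k v ord0 k * peval (mderiv k (g j)) p = 0) ->
  (forall i j, \sum_k v ord0 k * peval (mderiv k (B i j)) p = 0) -> v = 0.
Hypothesis J_generated : forall f, J f -> exists P Q (h : 'I_q -> mpoly N R[i]),
  peval Q p != 0 /\ Q * f = P * \det B + \sum_j h j * g j.

Lemma node_coordinate_at i : peval (node_coordinate i) p = 0.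
Proof.
case: i => -[|[|[|[|//]]]] ?;
rewrite /node_coordinate /= pevalM ?pevalB ?pevalD !Bp;
by rewrite ?addr0 ?subr0 mulr0.
Qed.

Lemma node_coordinate_jacobian (v : 'rV[R[i]]_N) :
  (forall i, \sum_k v ord0 k * peval (mderiv k (node_coordinate i)) p = 0) ->
  forall i j, \sum_k v ord0 k * peval (mderiv k (B i j)) p = 0.
Proof.
pose dv (P : mpoly N R[i]) := \sum_k v ord0 k * peval (mderiv k P) p.
have dvD P Q : dv (P + Q) = dv P + dv Q.
  rewrite /dv -big_split; apply: eq_bigr => k _.
  by rewrite mderivD pevalD mulrDr.
have dvZ a P : dv (mpolyC N a * P) = a * dv P.
  rewrite /dv mulr_sumr; apply: eq_bigr => k _.
  by rewrite mderiv_mulC pevalM pevalC mulrCA.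
have dvB P Q : dv (P - Q) = dv P - dv Q.
  rewrite /dv -sumrB; apply: eq_bigr => k _.
  by rewrite mderivB pevalB mulrBr.
move=> db.
have d0 : dv (node_coordinate (@Ordinal 4 0 isT)) = 0 by exact: db.
have d1 : dv (node_coordinate (@Ordinal 4 1 isT)) = 0 by exact: db.
have d2 : dv (node_coordinate (@Ordinal 4 2 isT)) = 0 by exact: db.
have d3 : dv (node_coordinate (@Ordinal 4 3 isT)) = 0 by exact: db.
move: d0 d1 d2 d3; rewrite /node_coordinate /=.
rewrite !dvZ !dvB !dvD.
have i2 : ('i%C / 2 : R[i]) != 0.
  by rewrite mulf_neq0 ?invr_eq0 ?pnatr_eq0// -sqrf_eq0 sqr_i oppr_eq0 oner_eq0.
move=> /eqP; rewrite mulf_eq0 invr_eq0 pnatr_eq0/= => /eqP b0.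
move=> /eqP; rewrite mulf_eq0 (negbTE i2)/= subr_eq0 => /eqP b1.
move=> /eqP; rewrite mulf_eq0 (negbTE i2)/= => /eqP b2.
move=> /eqP; rewrite mulf_eq0 invr_eq0 pnatr_eq0/= subr_eq0 => /eqP b3.
have dbl (a : R[i]) : a + a = 0 -> a = 0.
  by move/eqP; rewrite -mulr2n mulrn_eq0/= => /eqP.
move: b0 b2; rewrite b1 b3 => /dbl b0 /dbl b2.
have ord2 (k : 'I_2) : k = ord0 \/ k = ord_max.
  by case: k => -[|[|k]] k2; [left | right |]; first [exact: val_inj | by []].
move=> i j; suff : dv (B i j) = 0 by [].
have [->|->] := ord2 i; have [->|->] := ord2 j.
- exact: etrans b1 b0.
- exact: etrans b3 b2.
- exact: b2.
- exact: b0.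
Qed.

Lemma analytic_ideal_mem (K : nat) (I : set (mpoly K R[i])) z f
    (h G : 'rV[R[i]]_K -> R[i]) :
  I f -> holomorphic_near z h -> (\forall w \near z, G w = h w * peval f w) ->
  analytic_ideal I z G.
Proof.
move=> If hh GE; exists 1%N, (fun=> f), (fun=> h); split=> //.
by apply: filterS GE => w ->; rewrite big_ord1.
Qed.

(** The g_j cut out a smooth fourfold on which the entries of B are coordinates
centred at p. In these coordinates the ideal J is generated by det(B), the
quadratic form of node_equation up to the linear change of variables above. *)
Lemma node_germ_iso : analytic_germ_iso J p [set node_equation R] 0.
Proof.
have jac (v : 'rV[R[i]]_N) :
    (forall j, \sum_k v ord0 k * peval (mderiv k (g j)) p = 0) ->
    (forall i, \sum_k v ord0 k * peval (mderiv k (node_coordinate i)) p = 0) ->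
    v = 0.
  by move=> dg db; apply: jacobian_free => //; exact: node_coordinate_jacobian.
have [Psi [h [Psi0 Psi_hol PsiP h_hol hE]]] :=
  analytic_section_of_dim N_eq gp node_coordinate_at jac.
have Phi0 : Phi p = 0.
  by apply/rowP => i; rewrite !mxE node_coordinate_at.
exists Phi, Psi; split.
- split=> //; apply: holomorphic_everywhere => z.
  exact: differentiable_peval_row.
- by [].
- move=> f ->; apply: (analytic_ideal_mem (h := fun=> 1) detBJ).
    by apply: holomorphic_everywhere => z; exact: differentiable_cst.
  by apply: filterE => z; rewrite mul1r node_equation_coordinate.
- move=> f /J_generated[P [Q [k [Qp QfE]]]].
  pose u w := peval P (Psi w) / peval Q (Psi w).
  have Psi_coord w l :
      differentiable Psi w -> differentiable (fun w => Psi w ord0 l) w.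
    move=> dPsi; have -> : (fun w => Psi w ord0 l)
      = (fun z : 'rV[R[i]]_N => z ord0 l) \o Psi by [].
    by apply: differentiable_comp => //; exact: differentiable_coord.
  have QPsi : \forall w \near (0 : 'rV[R[i]]_4), peval Q (Psi w) != 0.
    have dQ : differentiable (fun w => peval Q (Psi w)) 0.
      apply: differentiable_peval => l; apply: Psi_coord.
      exact: nbhs_singleton Psi_hol.
    have Qp_gt0 : 0 < `|peval Q (Psi 0)| by rewrite Psi0 normr_gt0.
    have /cvgrPdist_lt/(_ _ Qp_gt0) := differentiable_continuous dQ.
    by apply: filterS => w; apply: contraTneq => ->; rewrite subr0 ltxx.
  apply: (@analytic_ideal_mem _ _ _ (node_equation R) u) => //.
    apply: filterS2 Psi_hol QPsi => w dPsi Qw.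
    apply: differentiableM.
      by apply: differentiable_peval => l; exact: Psi_coord.
    apply: differentiableV => //.
    by apply: differentiable_peval => l; exact: Psi_coord.
  apply: filterS2 PsiP QPsi => w [gw Phiw] Qw.
  have -> : peval (node_equation R) w = peval (\det B) (Psi w).
    by rewrite -node_equation_coordinate /Phi Phiw.
  have := congr1 (fun F => peval F (Psi w)) QfE.
  have gk0 : peval (\sum_j k j * g j) (Psi w) = 0.
    by rewrite peval_sum big1// => j _; rewrite pevalM gw mulr0.
  rewrite pevalD !pevalM gk0 addr0 => QfEw.
  by apply: (mulfI Qw); rewrite QfEw /u; field.
- split=> k.
    exists q, g, (fun j => h j k); split=> [//|j|]; first exact: h_hol.
    by apply: filterS hE => z; exact.
  exists 0%N, (fun=> 0), (fun _ _ => 0); split=> [[]//|[]//|].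
  by apply: filterS PsiP => w [_ PhiPsi]; rewrite /Phi PhiPsi subrr big_ord0.
Qed.

End NodeGerm.

(** * Degeneracy loci *)

Section Degeneracy.
Variables (R : realType) (M : prevariety R) (n : nat) (E F : vbundle M n.+1).
Variable sigma : vbmorphism E F.

Lemma trans_inverse (V : vbundle M n.+1) (a a' : triv V) y :
  triv_dom a y -> triv_dom a' y -> trans a a' y *m trans a' a y = 1%:M.
Proof. by move=> ya ya'; rewrite trans_cocycle// trans_id. Qed.

Lemma mor_mx_change a a' b b' y :
  triv_dom a y -> triv_dom a' y -> triv_dom b y -> triv_dom b' y ->
  mor_mx sigma a' b' y = trans b b' y *m mor_mx sigma a b y *m trans a' a y.
Proof.
move=> ya ya' yb yb'; rewrite -(mor_compat sigma ya ya' yb yb').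
by rewrite -mulmxA trans_inverse// mulmx1.
Qed.

Lemma trans_unit (V : vbundle M n.+1) (a a' : triv V) y :
  triv_dom a y -> triv_dom a' y -> trans a a' y \in unitmx.
Proof. by move=> ya ya'; have [] := mulmx1_unit (trans_inverse ya ya'). Qed.

Lemma rank_mor_mx a a' b b' y :
  triv_dom a y -> triv_dom a' y -> triv_dom b y -> triv_dom b' y ->
  \rank (mor_mx sigma a' b' y) = \rank (mor_mx sigma a b y).
Proof.
move=> ya ya' yb yb'; rewrite (mor_mx_change ya ya' yb yb').
rewrite mxrankMfree ?row_free_unit ?trans_unit//.
by rewrite eqmxMfull// row_full_unit trans_unit.
Qed.

Lemma degeneracy_stratum_rank a b x : triv_dom a x -> triv_dom b x ->
  degeneracy_stratum sigma (\rank (mor_mx sigma a b x)) x.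
Proof.
move=> ax bx; split; first by exists a, b.
case rk: (\rank (mor_mx sigma a b x)) => [|r]; first by [].
move=> [a' [b' [a'x b'x]]].
by rewrite (rank_mor_mx ax a'x bx b'x) rk ltnn.
Qed.

Section AtPoint.
Variables (c : chart M) (x : M) (a : triv E) (b : triv F).
Hypotheses (cx : chart_dom c x) (ax : triv_dom a x) (bx : triv_dom b x).

Lemma near_mor_mx_change a' b' : triv_dom a' x -> triv_dom b' x ->
  near_in c x (fun y => mor_mx sigma a' b' y
                        = trans b b' y *m mor_mx sigma a b y *m trans a' a y).
Proof.
move=> a'x b'x.
have na (V : vbundle M n.+1) (e : triv V) (ex : triv_dom e x) :
    near_in c x (triv_dom e).
  exact: near_in_open cx (@triv_open _ _ _ _ e) ex.
have := near_inS2 (fun y => @conj _ _) (na _ _ ax) (na _ _ a'x).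
have := near_inS2 (fun y => @conj _ _) (na _ _ bx) (na _ _ b'x).
by apply: near_inS2 => y [yb yb'] [ya ya']; exact: mor_mx_change.
Qed.

Lemma regular_jet_mx (v : 'rV[R[i]]_(chart_dim c)) m k
    (S : M -> 'M[R[i]]_(m, k)) :
  (forall i j, regular_at x (fun y => S y i j)) -> exists U, jet_mx x v S U.
Proof.
move=> regS.
have /choice[U UP] : forall ij : 'I_m * 'I_k, exists u : {poly R[i]},
    jet x v (fun y => S y ij.1 ij.2) u.
  move=> ij; apply: (regular_jet (c := c)).
  by apply/(regular_in_at cx); exact: regS.
by exists (\matrix_(i, j) U (i, j)) => i j; rewrite mxE; exact: UP (i, j).
Qed.

(** A matrix that factors through dimension r <= i to first order along v has
all its minors of size i + 1 zero to that order; changing the trivializations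
multiplies the two factors by invertible matrices. *)
Lemma degeneracy_ideal_jet0 (v : 'rV[R[i]]_(chart_dim c)) r i
    (A1 : 'M[{poly R[i]}]_(n.+1, r)) (A2 : 'M[{poly R[i]}]_(r, n.+1)) f :
  jet_mx x v (mor_mx sigma a b) (A1 *m A2) -> (r <= i)%N ->
  degeneracy_ideal sigma i x f -> jet x v f 0.
Proof.
move=> jA ri [a' [b' [a'x b'x [h [h_reg [U [Uo Ux fE]]]]]]].
have [V jV] := regular_jet_mx v (trans_regular bx b'x).
have [W jW] := regular_jet_mx v (trans_regular a'x ax).
have j' : jet_mx x v (mor_mx sigma a' b') ((V *m A1) *m (A2 *m W)).
  have := jet_mulmx (jet_mulmx jV jA) jW; rewrite mulmxA -(mulmxA V).
  move=> jj k l; apply: jet_near (jj k l); last by rewrite !mulmxA.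
  by apply: near_inS (near_mor_mx_change a'x b'x) => y ->.
have minor0 (t : {ffun 'I_i.+1 -> 'I_n.+1} * {ffun 'I_i.+1 -> 'I_n.+1}) :
    jet x v (fun y => \det (mxsub t.1 t.2 (mor_mx sigma a' b' y))) 0.
  have := jet_det (S := fun y => mxsub t.1 t.2 (mor_mx sigma a' b' y))
    (U := rowsub t.1 (V *m A1) *m colsub t.2 (A2 *m W)).
  rewrite det_mulmx_thin//; apply => k l; under eq_fun do rewrite mxE.
  by rewrite -mxsub_mul mxE; exact: j'.
have /choice[u uP] : forall t, exists ut : {poly R[i]}, jet x v (h t) ut.
  move=> t; apply: (regular_jet (c := c)).
  by apply/(regular_in_at cx); exact: h_reg.
have jsum := jet_sum (index_enum _) (fun t => jetM (uP t) (minor0 t)).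
apply: jet_near jsum; last by rewrite big1// => t _; rewrite mulr0.
exact: near_inS fE (near_in_open cx Uo Ux).
Qed.

(** In the ideal of the hypersurface the trivializations may vary from one
element to another; relative to those fixed here, each element is a multiple
of the same determinant. *)
Lemma degeneracy_ideal_multiple_det f : degeneracy_ideal sigma n x f ->
  exists P Q, peval Q (coord c x) != 0 /\
    near_in c x (fun y => f y * peval Q (coord c y)
                          = peval P (coord c y) * \det (mor_mx sigma a b y)).
Proof.
move=> [a' [b' [a'x b'x [h [h_reg [U [Uo Ux fE]]]]]]].
pose v0 : 'rV[R[i]]_(chart_dim c) := 0.
have [V jV] := regular_jet_mx v0 (trans_regular bx b'x).
have [W jW] := regular_jet_mx v0 (trans_regular a'x ax).
have /choice[u uP] : forall t, exists ut : {poly R[i]}, jet x v0 (h t) ut.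
  move=> t; apply: (regular_jet (c := c)).
  by apply/(regular_in_at cx); exact: h_reg.
pose k (t : {ffun 'I_n.+1 -> 'I_n.+1} * {ffun 'I_n.+1 -> 'I_n.+1}) : R[i] :=
  \det (rowsub t.1 1%:M) * \det (colsub t.2 1%:M).
have [P [Q [[Qx QE] _]]] := jetM (jet_sum (index_enum _)
  (fun t => jetM (uP t) (jet_cst x v0 (k t)))) (jetM (jet_det jV) (jet_det jW)).
exists P, Q; split=> //.
have := near_inS2 (fun y => @conj _ _) (near_in_open cx Uo Ux)
  (near_mor_mx_change a'x b'x).
apply: near_inS2 QE => y QE [Uy morE]; rewrite -QE fE// morE.
have -> : \sum_t h t y * \det (mxsub t.1 t.2
      (trans b b' y *m mor_mx sigma a b y *m trans a' a y))
    = (\sum_t h t y * k t)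
      * \det (trans b b' y *m mor_mx sigma a b y *m trans a' a y).
  rewrite mulr_suml; apply: eq_bigr => t _; rewrite det_mxsub_square /k.
  by rewrite mulrA -!mulrA; congr (_ * (_ * _)); rewrite mulrC.
by rewrite !det_mulmx; ring.
Qed.

Lemma degeneracy_ideal_det f h : regular_at x h ->
  near_in c x (fun y => f y = h y * \det (mor_mx sigma a b y)) ->
  degeneracy_ideal sigma n x f.
Proof.
move=> h_reg fE; exists a, b; split=> //.
pose idf : {ffun 'I_n.+1 -> 'I_n.+1} := [ffun k => k].
have [U [Uo Ux UE]] := near_in_open_set cx fE.
exists (fun t => if t == (idf, idf) then h else fun=> 0); split.
  move=> t; case: ifP => // _; apply/(regular_in_at cx).
  exact: regular_cst.
exists U; split=> // y Uy; rewrite (UE y Uy) (bigD1 (idf, idf))//= eqxx.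
rewrite big1 ?addr0 => [|t /negbTE ->]; last by rewrite mul0r.
by congr (_ * \det _); apply/matrixP => k l; rewrite mxE !ffunE.
Qed.

End AtPoint.
End Degeneracy.

(** * Nodality *)

(** The codimension of a nonempty stratum of corank at least 2 is at least 4,
so it fits in a fourfold only for corank 2, and then it has dimension 0. *)
Lemma corank_eq2 (n r d : nat) :
  (r < n)%N -> (d + (n.+1 - r) ^ 2)%N = 4 -> n = r.+1 /\ d = 0%N.
Proof.
move=> rn; have -> : n = (r + (n - r.+1).+1)%N by rewrite addnS -addSn subnKC.
move: (n - r.+1)%N => k; rewrite -addnS addKn => dk.
have k0 : k = 0%N.
  case: k dk => [//|k] dk.
  have : (3 ^ 2 <= k.+3 ^ 2)%N by rewrite leq_exp2r.
  by rewrite -[leqRHS]/(k.+3 ^ 2)%N => /leq_trans/(_ (leq_addl d _)); rewrite dk.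
by move: dk; rewrite k0 addn1 => /(canRL (addnK _)) ->.
Qed.

Theorem theorem1p1 (R : realType) (M : variety R) (n : nat)
    (E F : vbundle M n.+1) (sigma : vbmorphism E F)
    (M_smooth : smooth_of_dim M 4) (M_proper : proper_variety M)
    (sigma_general : n_general sigma 4)
    (D_irreducible : irreducible_subset (degeneracy_locus sigma n)) :
  nodal (degeneracy_locus sigma n) (degeneracy_ideal sigma n).
Proof.
move=> x [a [b [ax bx rk_le]]] sing; split=> //.
have stratum := degeneracy_stratum_rank sigma ax bx.
have [d [codim smooth_stratum]] := sigma_general _ _ rk_le stratum.
have rk_lt : (\rank (mor_mx sigma a b x) < n)%N.
  rewrite ltn_neqAle rk_le andbT; apply/eqP => rk_n; apply: sing.
  by exists d; rewrite rk_n in smooth_stratum.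
have [rk_n d0] := corank_eq2 rk_lt codim.
move: rk_n smooth_stratum.
move: {-2}(\rank _) (erefl (\rank (mor_mx sigma a b x))) => r rk.
move=> n_eq; rewrite d0 => smooth_stratum {codim d d0 stratum rk_le rk_lt}.
have [c [cx [q [g [dim_c gI g_gen _]]]]] := M_smooth x.
have [c' [c'x [s [f [dim_c' fI _ rk_f]]]]] := smooth_stratum.
subst n.
have reg_mor k l : regular_in c x (fun y => mor_mx sigma a b y k l).
  by apply/(regular_in_at cx); exact: mor_regular.
have [B [kappa [Bp kappa_p detB factor]]] :=
  corank2_local_model cx reg_mor (esym rk).
have near_g j : near_in c x (fun y => peval (g j) (coord c y) = 0).
  have [h [_ [U [Uo Ux gU]]]] := gI j.
  by apply: near_inS (near_in_open cx Uo Ux) => y /gU; rewrite big_ord0.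
have zero_gen P : near_in c x (fun y => peval P (coord c y) = 0) ->
    exists Q (h : 'I_q -> mpoly (chart_dim c) R[i]),
      peval Q (coord c x) != 0 /\ Q * P = \sum_j h j * g j.
  move=> P0; apply: g_gen.
  have [U [Uo Ux UE]] := near_in_open_set cx P0.
  exists (fun=> fun=> 0); split=> [[]//|].
  by exists U; split=> // y Uy; rewrite big_ord0; exact: UE.
(* The chart c, in which M is cut out by the g_j, serves for the node. *)
exists c; split=> //; apply: (node_germ_iso dim_c (g := g) (B := B)).
- move=> j; apply: (degeneracy_ideal_det cx ax bx (h := fun=> 0)).
    by apply/(regular_in_at cx); exact: regular_cst.
  by apply: near_inS (near_g j) => y ->; rewrite mul0r.
- apply: (degeneracy_ideal_det cx ax bx (h := fun y => peval kappa (coord c y))).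
    by apply/(regular_in_at cx); exists kappa, 1; exact: represents_poly.
  by apply: near_inS detB => y; rewrite -peval_det.
- by move=> j; exact: (near_in_at cx (near_g j)).
- by move=> i j; have /matrixP/(_ i j) := Bp; rewrite !mxE.
- move=> v dg dB.
  have [A1 [A2 jA]] := factor v dB.
  have v_tangent : tangent_to x v.
    apply: (tangent_to_equations zero_gen _ dg) => j.
    exact: (near_in_at cx (near_g j)).
  (* The f_j generate the ideal of the stratum, the reduced point x. *)
  apply: (vanishing_jets_tangent0 cx c'x v_tangent (F := f)).
    move=> j; apply: (degeneracy_ideal_jet0 cx ax bx jA _ (fI j)) => //.
  by rewrite rk_f dim_c' addn0.
- move=> P /(degeneracy_ideal_multiple_det cx ax bx)[P1 [Q1 [Q1x PE]]].
  have : near_in c x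
      (fun y => peval (kappa * Q1 * P - P1 * \det B) (coord c y) = 0).
    apply: near_inS2 PE detB => y PE; rewrite -peval_det => dE.
    rewrite pevalB !pevalM dE [X in _ - X]mulrCA -PE.
    by rewrite -mulrA [_ * peval P _]mulrC subrr.
  move=> /zero_gen[Q [h [Qx QE]]].
  exists (Q * P1), (Q * (kappa * Q1)), h; split.
    by rewrite !pevalM !mulf_neq0.
  by rewrite -QE mulrBr !mulrA addrCA subrr addr0.
Qed.
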